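(* Let $w=t_\lambda\bar w\in\mathrm{Adm}_{G_r}(\mu)$ and let $J\subseteq\Phi$ be a root subsystem. Then $$\widetilde R^J_{w,t_\lambda}(Q_r)=\sum_{J'\subseteq J}\ \sum_{\substack{\Delta\in B_\Phi^\prec(w_\lambda^{-1}\bar w,\,w_\lambda^{-1})\\ J_\Delta=J'}}Q_r^{\ell(\Delta)},$$ where the outer sum is over root subsystems $J'$ of $J$.
   Context: $G$ is a split connected reductive group (with connected center) over a non-archimedean local field $F$ with residue field of cardinality $q$; $r\ge1$; $T\subset B$ a split maximal torus and Borel, $\Phi=\Phi(G,T)$, $(W,S)$ the finite Weyl group. $Q_r=q^{-r/2}-q^{r/2}$. $\widetilde W=X_*(T)\rtimes W=W_{\mathrm{aff}}\rtimes\Omega$ is the extended affine Weyl group, $W_{\mathrm{aff}}$ being generated by reflections in the walls of the base alcove (in the $B$-positive chamber, origin in closure) and $\Omega$ the stabilizer of the alcove; length and Bruhat order are extended to $\widetilde W$ with $\Omega$ in length $0$ and $\sigma u\le\sigma'u'$ iff $\sigma=\sigma'$, $u\le u'$. $\mu\in X_*(T)$ is dominant minuscule and $\mathrm{Adm}_{G_r}(\mu)=\{w\in\widetilde W:w\le t_\eta\text{ for some }\eta\in W\mu\}$. Write $w=t_\lambda\bar w$, $\lambda\in X_*(T)$, $\bar w\in W$; $w_\lambda\in W$ is the unique element with $t_\lambda w_\lambda$ of minimal length in $t_\lambda W$. **Paths.** The Bruhat graph of $W$ has directed edges $u\to ut$ for reflections $t$ with $\ell(u)<\ell(ut)$. For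 a directed path $\Delta:u=u_0\to\dots\to u_n=v$ the edges are $t_i=u_{i-1}^{-1}u_i$, $E(\Delta)=\{t_1,\dots,t_n\}$, $\ell(\Delta)=n$. A reflection ordering on a Coxeter group is a total order $\prec$ on its positive roots (equivalently reflections) such that whenever $\alpha,\beta,a\alpha+b\beta$ are positive roots with $a,b>0$ real, either $\alpha\prec a\alpha+b\beta\prec\beta$ or $\beta\prec a\alpha+b\beta\prec\alpha$. $\prec$ is a fixed reflection ordering on $W_{\mathrm{aff}}$, restricted to $W$. $B^\prec_\Phi(u,v)$ is the set of paths from $u$ to $v$ in the Bruhat graph of $W$ with $t_1\prec\dots\prec t_n$. A root subsystem is a subset $J\subseteq\Phi$ with $s_\alpha(J)=J$ for $\alpha\in J$, and $W_J=\langle s_\alpha:\alpha\in J\rangle$. $J_\Delta$ is the smallest root subsystem with $E(\Delta)\subset W_{J_\Delta}$ (empty for the empty path). **$\widetilde R^J$.** $J_{\mathrm{aff}}=\{\alpha+k:\alpha\in J,k\in\mathbb Z\}$, $W_{J,\mathrm{aff}}=\langle s_a:a\in J_{\mathrm{aff}}\rangle$, a Coxeter group whose generators are the reflections in the simple roots of $J_{\mathrm{aff}}$ for the positive system $J_{\mathrm{aff}}\cap\Phi_{\mathrm{aff}}^+$; $\widetilde W_J=X_*(T)\rtimes W_J=W_{J,\mathrm{aff}}\rtimes\Omega_J$ with $\Omega_J$ the stabilizer of the base alcove of $J$, and $\ell_J$ its length function. The twisted affine Hecke algebra of $\widetilde W_J$ has basis $T_x$, $x\in\widetilde W_J$, with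 $T_xT_y=T_{xy}$ if $\ell_J(xy)=\ell_J(x)+\ell_J(y)$ and $T_s^2=(q^r-1)T_s+q^r$ for simple reflections $s$. With $\tilde T_x=q^{-r\ell_J(x)/2}T_x$, the polynomials are defined by $\tilde T_{y^{-1}}^{-1}=\sum_{x\in\widetilde W_J}\widetilde R^J_{x,y}(Q_r)\tilde T_x$. One sets $\widetilde R^J_{w,t_\lambda}=0$ if $w\notin\widetilde W_J$. *)

(* Defs.v *)
From Stdlib Require Import Relation_Operators.
From mathcomp Require Import all_boot all_order all_algebra.
From mathcomp Require Import boolp classical_sets fsbigop.

Set Implicit Arguments.
Unset Strict Implicit.
Unset Printing Implicit Defensive.

Import Order.TTheory GRing.Theory Num.Theory.
Local Open Scope ring_scope.

(* Cocharacters X_*(T) = Z^n are integer columns, characters X^*(T) are integer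
   rows, and the perfect pairing <chi, lambda> is the matrix product. *)
Definition pairing (R : comPzRingType) n (chi : 'rV[R]_n) (v : 'cV[R]_n) : R :=
  (chi *m v) 0 0.

(* The reduced root datum of a split connected reductive group with respect to
   a split maximal torus T of rank n, based by a Borel subgroup containing T.
   Roots are indexed by a finite type so that root subsystems are {set _}. *)
Record rootDatum (n : nat) := RootDatum {
  Phi :> finType;
  root : Phi -> 'rV[int]_n;
  coroot : Phi -> 'cV[int]_n;
  root_inj : injective root;
  coroot_inj : injective coroot;
  pairing_root_coroot : forall a, pairing (root a) (coroot a) = 2;
  refl_root : forall a b, exists c,
    root c = root b - pairing (root b) (coroot a) *: root a;
  refl_coroot : forall a b, exists c,
    coroot c = coroot b - pairing (root a) (coroot b) *: coroot a;
  root_reduced : forall a b, root b <> 2 *: root a;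
  (* the roots of T in the Borel subgroup *)
  posroots : {set Phi};
  posroots_generic : exists x : 'cV[int]_n, forall a,
    pairing (root a) x != 0 /\ (a \in posroots) = (0 < pairing (root a) x)
}.

(* The centre of G is the diagonalizable group with character group
   X^*(T) / Z Phi; it is a (connected) torus iff that group is torsion-free. *)
Definition in_root_lattice n (D : rootDatum n) (chi : 'rV[int]_n) : Prop :=
  exists c : D -> int, chi = \sum_(a : D) c a *: root a.

Definition connected_center n (D : rootDatum n) : Prop :=
  forall (chi : 'rV[int]_n) (m : int), m != 0 ->
    in_root_lattice D (m *: chi) -> in_root_lattice D chi.

Definition dominant n (D : rootDatum n) (mu : 'cV[int]_n) : Prop :=
  forall a, a \in posroots D -> 0 <= pairing (root a) mu.

Definition minuscule n (D : rootDatum n) (mu : 'cV[int]_n) : Prop :=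
  forall a : D, pairing (root a) mu \in [:: -1; 0; 1].

(* Least element of a nonempty set of naturals. *)
Definition least (P : nat -> Prop) : nat :=
  xget 0%N [set k | P k /\ forall m, P m -> (k <= m)%N]%classic.

Section FiniteWeylGroup.
Variables (n : nat) (D : rootDatum n).
Implicit Types (a b c : D) (u v A : 'M[int]_n) (J : {set D}) (p : seq D).

(* s_a as an automorphism of X_*(T): x |-> x - <a, x> a^vee; right
   multiplication by the same matrix is s_a on X^*(T). *)
Definition refl a : 'M[int]_n := 1%:M - coroot a *m root a.

Definition root_subsystem J : bool :=
  [forall a in J, forall b,
     (b \in J) == [exists c in J, root b == root c *m refl a]].

Definition refl_prod (s : seq D) : 'M[int]_n :=
  \big[mulmx/1%:M]_(a <- s) refl a.

Definition in_W_ J u : Prop :=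
  exists2 s : seq D, {subset s <= J} & u = refl_prod s.

Definition in_W : 'M[int]_n -> Prop := in_W_ [set: D].

Definition simple_root a : bool :=
  (a \in posroots D) &&
  ~~ [exists b in posroots D, exists c in posroots D,
        root a == root b + root c].

Definition Wlength u : nat :=
  least (fun k => exists s : seq D,
    [/\ size s = k, all simple_root s & u = refl_prod s]).

(* A directed path in the Bruhat graph of W from u to v, given by the positive
   roots of its successive edges t_1, ..., t_k. *)
Fixpoint bruhat_path u p v : Prop :=
  if p is a :: p' then
    [/\ a \in posroots D, (Wlength u < Wlength (u *m refl a))%N
      & bruhat_path (u *m refl a) p' v]
  else u = v.

(* J is J_Delta for a path Delta with edge roots p. *)
Definition is_JDelta p J : Prop :=
  let contains J0 := root_subsystem J0 /\ {in p, forall a, in_W_ J0 (refl a)} in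
  contains J /\ forall J0, contains J0 -> J \subset J0.

End FiniteWeylGroup.

(* t_lambda A is the pair (lambda, A), acting by x |-> lambda + A x. *)
Definition ext (n : nat) : Type := ('cV[int]_n * 'M[int]_n)%type.

Section ExtendedGroup.
Variable n : nat.
Implicit Types x y : ext n.

Definition eone : ext n := (0, 1%:M).
Definition emul x y : ext n := (x.1 + x.2 *m y.1, x.2 *m y.2).
Definition einv x : ext n := (- (invmx x.2 *m x.1), invmx x.2).
Definition transl (lambda : 'cV[int]_n) : ext n := (lambda, 1%:M).
Definition eact (R : rcfType) x (v : 'cV[R]_n) : 'cV[R]_n :=
  map_mx intr x.1 + map_mx intr x.2 *m v.

End ExtendedGroup.

Section AffineWeylGroup.
(* R plays the role of the real numbers. *)
Variables (R : rcfType) (n : nat) (D : rootDatum n).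
Implicit Types (J : {set D}) (x y u v : ext n) (z : 'cV[R]_n).

(* The pair (a, k) is the affine root a + k. *)
Definition affroot : Type := (D * int)%type.
Implicit Types a b c : affroot.

Definition aff_eval a z : R := pairing (map_mx intr (root a.1)) z + (a.2)%:~R.

(* z |-> z - (a + k)(z) a^vee *)
Definition aff_refl a : ext n := (- (a.2 *: coroot a.1), refl a.1).

(* The alcove of the chamber of B whose closure contains the origin. *)
Definition base_alcove z : Prop :=
  forall a : D, a \in posroots D ->
    0 < pairing (map_mx intr (root a)) z < 1.

Definition aff_pos a : Prop := forall z, base_alcove z -> 0 < aff_eval a z.

Definition aff_pos_ J a : Prop := a.1 \in J /\ aff_pos a.

(* Decompositions into more than two roots have to be considered, since the
   constant function 1 is not an affine root: a + 1 = (- a + 1) + a + a. *)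
Definition aff_simple J a : Prop :=
  aff_pos_ J a /\
  ~ exists s : seq affroot,
      [/\ (1 < size s)%N, forall b, b \in s -> aff_pos_ J b
        & forall z, aff_eval a z = \sum_(b <- s) aff_eval b z].

Definition alcove J z : Prop := forall a, aff_pos_ J a -> 0 < aff_eval a z.

Definition aff_prod (s : seq affroot) : ext n :=
  \big[@emul n/eone n]_(a <- s) aff_refl a.

(* W_{J,aff}, ~W_J = X_*(T) x| W_J and Omega_J *)
Definition in_Waff J x : Prop :=
  exists2 s : seq affroot, (forall a, a \in s -> a.1 \in J) & x = aff_prod s.

Definition in_Wext J x : Prop := in_W_ J x.2.

Definition in_Omega J x : Prop :=
  in_Wext J x /\ [set eact x z | z in alcove J]%classic = alcove J.

(* ell_J of u sigma, with u in W_{J,aff} and sigma in Omega_J, is the Coxeter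
   length of u. *)
Definition ext_length J x : nat :=
  least (fun k => exists (s : seq affroot) (sigma : ext n),
    [/\ size s = k, forall a, a \in s -> aff_simple J a, in_Omega J sigma
      & x = emul (aff_prod s) sigma]).

Definition aff_bruhat_step u v : Prop :=
  (exists a : affroot, v = emul u (aff_refl a)) /\
  (ext_length [set: D] u < ext_length [set: D] v)%N.

Definition bruhat_le x y : Prop :=
  exists sigma u v, [/\ in_Omega [set: D] sigma,
    in_Waff [set: D] u /\ in_Waff [set: D] v,
    x = emul sigma u, y = emul sigma v
    & clos_refl_trans (ext n) aff_bruhat_step u v].

Definition Adm (mu : 'cV[int]_n) x : Prop :=
  in_Wext [set: D] x /\
  exists2 A, in_W D A & bruhat_le x (transl (A *m mu)).

(* w = w_lambda: t_lambda w has minimal length in t_lambda W. *)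
Definition is_min_rep (lambda : 'cV[int]_n) (w : 'M[int]_n) : Prop :=
  in_W D w /\ forall w', in_W D w' ->
    (ext_length [set: D] (lambda, w) <= ext_length [set: D] (lambda, w'))%N.

Definition reflection_order (prec : rel affroot) : Prop :=
  [/\ forall a, aff_pos a -> ~~ prec a a,
      forall a b c, aff_pos a -> aff_pos b -> aff_pos c ->
        prec a b -> prec b c -> prec a c,
      forall a b, aff_pos a -> aff_pos b -> a != b -> prec a b || prec b a
    & forall a b c (x y : R), aff_pos a -> aff_pos b -> aff_pos c -> a != b ->
        0 < x -> 0 < y ->
        (forall z, aff_eval c z = x * aff_eval a z + y * aff_eval b z) ->
        (prec a c && prec c b) || (prec b c && prec c a)].

(* B_Phi^prec(u, v), the order being restricted to the roots a + 0 of W. *)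
Definition increasing_paths (prec : rel affroot) (u v : 'M[int]_n) :
    set (seq D) :=
  [set p | bruhat_path u p v /\
           sorted (fun a b : D => prec (a, 0) (b, 0)) p]%classic.

End AffineWeylGroup.

Section HeckeAlgebra.
Variables (R : rcfType) (n : nat) (D : rootDatum n) (q r : nat).
Variables (J : {set D}) (H : unitAlgType R) (T : ext n -> H).

(* q ^ (r / 2) *)
Definition sqrtqr : R := Num.sqrt (q%:R ^+ r).

Definition Qr : R := sqrtqr^-1 - sqrtqr.

(* H, with the family T_x for x in ~W_J (the other values of T play no role),
   is the twisted affine Hecke algebra of ~W_J with parameter q ^ r. *)
Definition hecke_algebra : Prop :=
  [/\ forall (s : seq (ext n)) (c : ext n -> R),
        uniq s -> (forall x, x \in s -> in_Wext J x) ->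
        \sum_(x <- s) c x *: T x = 0 -> forall x, x \in s -> c x = 0,
      forall h : H, exists (s : seq (ext n)) (c : ext n -> R),
        (forall x, x \in s -> in_Wext J x) /\ h = \sum_(x <- s) c x *: T x,
      forall x y, in_Wext J x -> in_Wext J y ->
        ext_length R J (emul x y) = (ext_length R J x + ext_length R J y)%N ->
        T x * T y = T (emul x y)
    & forall a, aff_simple R J a ->
        T (aff_refl a) ^+ 2 =
          (q%:R ^+ r - 1) *: T (aff_refl a) + (q%:R ^+ r)%:A].

Definition Ttilde (x : ext n) : H := (sqrtqr ^- ext_length R J x) *: T x.

Definition evalR (P : {poly int}) (c : R) : R := (map_poly intr P).[c].

(* Rt x y is ~R^J_(x,y), extended by 0 to x outside of ~W_J. *)
Definition Rtilde_polynomials (Rt : ext n -> ext n -> {poly int}) : Prop :=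
  (forall x y, ~ in_Wext J x -> Rt x y = 0) /\
  forall y, in_Wext J y -> exists s : seq (ext n),
    [/\ uniq s, forall x, x \in s -> in_Wext J x,
        forall x, x \notin s -> Rt x y = 0
      & (Ttilde (einv y))^-1 = \sum_(x <- s) evalR (Rt x y) Qr *: Ttilde x].

End HeckeAlgebra.

(* Main.v *)
(** The formula holds for every element [t_lambda wbar] of the extended affine
    Weyl group: neither admissibility nor minuscularity matters.

    Let [m] be the element of minimal length in [t_lambda W_J], and write
    [t_lambda = m y] with [y] in [W_J].  Then [bar T_(t_lambda) = bar T_m bar T_y],
    where [bar T_x] is the inverse of [T_(x^-1)] (all normalized).  Since [bar T_m]
    is [T_m] plus terms of smaller length, which lie outside the coset [m W_J], the
    coefficient of [T_(m x)] is that of [T_x] in [bar T_y]: only R-polynomials of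
    the finite group [W_J] intervene.  These count the paths of the Bruhat graph of
    [W_J] with edges increasing for the reflection order (Dyer).  Left multiplication
    by [w_lambda^-1 m] and by [m] are both compatible with the Bruhat graphs, which
    turns these paths into the paths in [W] with edges in [J], and [J_Delta] is
    contained in [J] if and only if the edges of [Delta] are.

    Dyer's formula is proved by intertwining.  For the initial sections [A] of the
    order, twist the left regular representation of the Hecke algebra by exchanging
    the roles of [s x < x] and [s x > x] whenever the reflection [x^-1 s x] belongs
    to [A].  If [b] is the next root after [A], the operator [x |-> x + Q x s_b]
    (the second term being present when [x b < 0]) intertwines the twists by
    [A + b] and by [A], because [b] is simple for the positive system twisted by
    [A].  The composition of these operators over all of the order sends [y] to the
    generating function of the increasing paths ending in [y], and it has to be
    [bar T_y] as its source is the completely twisted representation. *)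

From Pilot Require Import Defs.
From mathcomp Require Import all_boot all_order all_algebra.
From mathcomp Require Import boolp classical_sets fsbigop.
From mathcomp Require Import zify ring lra.
(* Gives [root] back its meaning of Defs, hidden by that of mathcomp's poly. *)
Import Pilot.Defs.

Set Implicit Arguments.
Unset Strict Implicit.
Unset Printing Implicit Defensive.

Import Order.TTheory GRing.Theory Num.Theory.
Local Open Scope ring_scope.

(** * Root data *)

Section Pairing.
Variables (R : comPzRingType) (n : nat).
Implicit Types (chi : 'rV[R]_n) (v : 'cV[R]_n) (A : 'M[R]_n).

Lemma pairing_mulmx chi A v : pairing (chi *m A) v = pairing chi (A *m v).
Proof. by rewrite /pairing mulmxA. Qed.

Lemma pairingDl chi psi v : pairing (chi + psi) v = pairing chi v + pairing psi v.
Proof. by rewrite /pairing mulmxDl mxE. Qed.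

Lemma pairingDr chi v w : pairing chi (v + w) = pairing chi v + pairing chi w.
Proof. by rewrite /pairing mulmxDr mxE. Qed.

Lemma pairingZl k chi v : pairing (k *: chi) v = k * pairing chi v.
Proof. by rewrite /pairing -scalemxAl mxE. Qed.

Lemma pairingZr k chi v : pairing chi (k *: v) = k * pairing chi v.
Proof. by rewrite /pairing -scalemxAr mxE. Qed.

Lemma pairingNl chi v : pairing (- chi) v = - pairing chi v.
Proof. by rewrite /pairing mulNmx mxE. Qed.

Lemma pairingNr chi v : pairing chi (- v) = - pairing chi v.
Proof. by rewrite /pairing mulmxN mxE. Qed.

Lemma pairing0r chi : pairing chi 0 = 0 :> R.
Proof. by rewrite /pairing mulmx0 mxE. Qed.

Lemma pairing_suml I (s : seq I) (P : pred I) (F : I -> 'rV[R]_n) v :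
  pairing (\sum_(i <- s | P i) F i) v = \sum_(i <- s | P i) pairing (F i) v.
Proof. by rewrite /pairing mulmx_suml summxE. Qed.

Lemma pairing_sumr I (s : seq I) (P : pred I) chi (F : I -> 'cV[R]_n) :
  pairing chi (\sum_(i <- s | P i) F i) = \sum_(i <- s | P i) pairing chi (F i).
Proof. by rewrite /pairing mulmx_sumr summxE. Qed.

Lemma mul_col_row (v : 'cV[R]_n) chi psi :
  psi *m (v *m chi) = pairing psi v *: chi.
Proof. by rewrite mulmxA [psi *m v]mx11_scalar mul_scalar_mx. Qed.

Lemma mul_col_row_col (v : 'cV[R]_n) chi w :
  v *m chi *m w = pairing chi w *: v.
Proof. by rewrite -mulmxA [chi *m w]mx11_scalar mul_mx_scalar. Qed.

End Pairing.

Section RootDatum.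
Variables (n : nat) (D : rootDatum n).
Implicit Types (a b c d : D) (chi psi : 'rV[int]_n) (v w : 'cV[int]_n).
Implicit Types (u : 'M[int]_n) (J : {set D}).

Local Notation "<< chi , v >>" := (pairing chi v).

Lemma mul_refl chi a : chi *m refl a = chi - <<chi, coroot a>> *: root a.
Proof. by rewrite /refl mulmxBr mulmx1 mul_col_row. Qed.

Lemma refl_mul a v : refl a *m v = v - <<root a, v>> *: coroot a.
Proof. by rewrite /refl mulmxBl mul1mx mul_col_row_col. Qed.

Lemma root_mul_refl a : root a *m refl a = - root a.
Proof.
rewrite mul_refl pairing_root_coroot scaler_nat mulr2n opprD addrA.
by rewrite subrr add0r.
Qed.

Lemma refl_mul_coroot a : refl a *m coroot a = - coroot a.
Proof.
rewrite refl_mul pairing_root_coroot scaler_nat mulr2n opprD addrA.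
by rewrite subrr add0r.
Qed.

Lemma reflK a : refl a *m refl a = 1%:M.
Proof.
rewrite {1}/refl mulmxBl mul1mx -mulmxA root_mul_refl mulmxN opprK.
by rewrite /refl subrK.
Qed.

Lemma refl_unit a : refl a \in unitmx.
Proof. by have [] := mulmx1_unit (reflK a). Qed.

Lemma invmx_refl a : invmx (refl a) = refl a.
Proof. by rewrite -[RHS](mulKmx (refl_unit a)) reflK mulmx1. Qed.

(** [refl_root] asserts only existence; picking the root gives a map of indices, and the default [b]
    merely makes it total. *)
Definition srefl a b : D := odflt b [pick c | root c == root b *m refl a].

Lemma root_srefl a b : root (srefl a b) = root b *m refl a.
Proof.
rewrite /srefl; case: pickP => [c /eqP //|no].
have [c hc] := refl_root a b.
by have := no c; rewrite hc mul_refl eqxx.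
Qed.

Lemma sreflK a : involutive (srefl a).
Proof. by move=> b; apply: root_inj; rewrite !root_srefl -mulmxA reflK mulmx1. Qed.

Definition oppD a : D := srefl a a.

Lemma root_oppD a : root (oppD a) = - root a.
Proof. by rewrite root_srefl root_mul_refl. Qed.

Lemma oppDK : involutive oppD.
Proof. by move=> a; apply: root_inj; rewrite !root_oppD opprK. Qed.

(* The W-equivariant map [chi |-> \sum_c <chi, c^v> c^v] sends [root a] to a
   nonzero multiple of [coroot a], so that the coroots are determined by the
   roots; [rform] is the invariant form that it induces. *)
Definition corsum chi : 'cV[int]_n := \sum_(c : D) <<chi, coroot c>> *: coroot c.

Definition rform chi psi : int := \sum_(c : D) <<chi, coroot c>> * <<psi, coroot c>>.

Lemma rformE chi psi : <<chi, corsum psi>> = rform chi psi.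
Proof. by rewrite pairing_sumr; apply: eq_bigr => c _; rewrite pairingZr mulrC. Qed.

Lemma rformC chi psi : rform chi psi = rform psi chi.
Proof. by apply: eq_bigr => c _; rewrite mulrC. Qed.

(** Kept apart from [srefl]: that roots and coroots are permuted alike is known only after
    [coroot_srefl]. *)
Definition corefl a b : D := odflt b [pick c | coroot c == refl a *m coroot b].

Lemma coroot_corefl a b : coroot (corefl a b) = refl a *m coroot b.
Proof.
rewrite /corefl; case: pickP => [c /eqP //|no].
have [c hc] := refl_coroot a b.
by have := no c; rewrite hc refl_mul eqxx.
Qed.

Lemma coreflK a : involutive (corefl a).
Proof.
by move=> b; apply: coroot_inj; rewrite !coroot_corefl mulmxA reflK mul1mx.
Qed.

Lemma corsum_refl chi a : corsum (chi *m refl a) = refl a *m corsum chi.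
Proof.
rewrite /corsum mulmx_sumr (reindex_inj (inv_inj (coreflK a))) /=.
apply: eq_bigr => c _.
rewrite coroot_corefl pairing_mulmx mulmxA reflK mul1mx.
by rewrite -scalemxAr.
Qed.

Lemma rform_refl chi psi a : rform (chi *m refl a) (psi *m refl a) = rform chi psi.
Proof. by rewrite -!rformE corsum_refl pairing_mulmx mulmxA reflK mul1mx. Qed.

(** Equivariance of [corsum] under [refl a], which negates [root a]. *)
Lemma corsum_root a : 2 *: corsum (root a) = rform (root a) (root a) *: coroot a.
Proof.
have := corsum_refl (root a) a; rewrite root_mul_refl refl_mul rformE.
have -> : corsum (- root a) = - corsum (root a).
  rewrite /corsum -sumrN; apply: eq_bigr => c _.
  by rewrite pairingNl scaleNr.
move=> h; rewrite scaler_nat mulr2n -[X in X + _]opprK h opprB.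
by rewrite subrK.
Qed.

Lemma rform_ge0 chi : 0 <= rform chi chi.
Proof. by apply: sumr_ge0 => c _; rewrite -expr2 sqr_ge0. Qed.

Lemma rform_root_gt0 a : 0 < rform (root a) (root a).
Proof.
rewrite /rform (bigD1 a) //= pairing_root_coroot ltr_wpDr //.
by apply: sumr_ge0 => c _; rewrite -expr2 sqr_ge0.
Qed.

Lemma rform_root chi a :
  2 * rform chi (root a) = rform (root a) (root a) * <<chi, coroot a>>.
Proof. by rewrite -rformE -!pairingZr corsum_root. Qed.

(** The two roots have the same nonzero norm, which cancels from their instances of
    [corsum_root]. *)
Lemma coroot_srefl a b : coroot (srefl a b) = refl a *m coroot b.
Proof.
have e : rform (root (srefl a b)) (root (srefl a b)) = rform (root b) (root b).
  by rewrite root_srefl rform_refl.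
have := corsum_root (srefl a b); rewrite e root_srefl corsum_refl.
rewrite scalemxAr corsum_root -scalemxAr => h.
apply/colP => i; have /colP/(_ i) := h; rewrite [LHS]mxE [RHS]mxE => hi.
exact: (mulfI (lt0r_neq0 (rform_root_gt0 b)) (esym hi)).
Qed.

Lemma refl_srefl a b : refl (srefl a b) = refl a *m refl b *m refl a.
Proof.
rewrite [refl (srefl a b)]/refl root_srefl coroot_srefl [refl b]/refl.
by move: (refl a) (reflK a) => A AA; rewrite mulmxBr mulmx1 mulmxBl AA !mulmxA.
Qed.

Lemma coroot_oppD a : coroot (oppD a) = - coroot a.
Proof. by rewrite coroot_srefl refl_mul_coroot. Qed.

Lemma refl_oppD a : refl (oppD a) = refl a.
Proof. by rewrite /refl root_oppD coroot_oppD mulmxN mulNmx opprK. Qed.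

(** Both pairings have the sign of [rform (root a) (root b)]. *)
Lemma pairing_gt0C a b : 0 < <<root a, coroot b>> -> 0 < <<root b, coroot a>>.
Proof.
move=> h.
have h1 := rform_root (root a) b; have h2 := rform_root (root b) a.
have pa := rform_root_gt0 a; have pb := rform_root_gt0 b.
rewrite (rformC (root b)) in h2.
have : 0 < rform (root a) (root a) * <<root b, coroot a>>.
  by rewrite -h2 h1 mulr_gt0.
by rewrite pmulr_rgt0.
Qed.

Lemma rformB (x y : int) chi psi :
  rform (x *: chi - y *: psi) (x *: chi - y *: psi) =
  x ^+ 2 * rform chi chi - 2 * x * y * rform chi psi + y ^+ 2 * rform psi psi.
Proof.
rewrite /rform !mulr_sumr -sumrB -big_split /=; apply: eq_bigr => c _.
by rewrite !pairingDl !pairingNl !pairingZl; ring.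
Qed.

(** The norm of [(psi, psi) chi - (chi, psi) psi] is nonnegative. The form is only semidefinite: if
    [psi] is isotropic, it pairs to zero with every coroot. *)
Lemma rform_cauchy chi psi :
  rform chi psi ^+ 2 <= rform chi chi * rform psi psi.
Proof.
have key : 0 <= rform (rform psi psi *: chi - rform chi psi *: psi)
                      (rform psi psi *: chi - rform chi psi *: psi) by apply: rform_ge0.
have E : rform (rform psi psi *: chi - rform chi psi *: psi)
               (rform psi psi *: chi - rform chi psi *: psi)
   = rform psi psi * (rform chi chi * rform psi psi - rform chi psi ^+ 2).
  by rewrite rformB; ring.
rewrite E in key.
have := rform_ge0 psi; rewrite le_eqVlt => /orP [/eqP h0|h0]; last first.
  by move: key; rewrite pmulr_rge0 // subr_ge0.
have hz c : <<psi, coroot c>> = 0.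
  have /eqP := esym h0; rewrite /rform psumr_eq0; last first.
    by move=> i _; rewrite -expr2 sqr_ge0.
  by move=> /allP /(_ c (mem_index_enum c)) /=; rewrite mulf_eq0 orbb => /eqP.
have -> : rform chi psi = 0.
  by apply: big1 => c _; rewrite hz mulr0.
by rewrite -h0 mulr0 expr0n.
Qed.

(** Otherwise [root a - root b] is nonzero and isotropic, and [s_a s_b] translates by twice this
    vector every root pairing to 2 with both coroots, contradicting finiteness. *)
Lemma root_pairing2 a b :
  <<root a, coroot b>> = 2 -> <<root b, coroot a>> = 2 -> a = b.
Proof.
move=> hab hba; apply: root_inj; apply/eqP; apply: contraT => ne.
have hD : rform (root a - root b) (root a - root b) = 0.
  have h1 := rform_root (root a) b; have h2 := rform_root (root b) a.
  rewrite hab in h1; rewrite hba (rformC (root b)) in h2.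
  have := rformB 1 1 (root a) (root b); rewrite !scale1r => ->.
  lia.
have hz c : <<root a - root b, coroot c>> = 0.
  move/eqP: hD; rewrite /rform psumr_eq0; last first.
    by move=> i _; rewrite -expr2 sqr_ge0.
  by move=> /allP /(_ c (mem_index_enum c)) /=; rewrite mulf_eq0 orbb => /eqP.
have [j hj] : exists j, (root a - root b) 0 j != 0.
  apply/existsP; apply: contraR ne => /existsPn h; rewrite -subr_eq0; apply/eqP/rowP => j.
  by rewrite [RHS]mxE; apply/eqP; have := h j; rewrite negbK.
pose P d := (<<root d, coroot a>> == 2) && (<<root d, coroot b>> == 2).
(* The weight [(root a - root b) 0 j] makes [f] grow by twice its square under the translation, so
   no root maximizes [f]. *)
pose f d : int := (root d) 0 j * (root a - root b) 0 j.
have Pa : P a by rewrite /P pairing_root_coroot hab eqxx.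
have [d] := Order.TotalTheory.arg_maxP f Pa.
move=> /andP [/eqP da /eqP db] /(_ (srefl a (srefl b d))).
have er : root (srefl a (srefl b d)) = root d + 2 *: (root a - root b).
  rewrite !root_srefl !mul_refl db pairingDl pairingNl pairingZl hba da.
  rewrite scalerBr -addrA; congr (_ + _); rewrite addrC; congr (_ + _).
  by rewrite -scaleNr; congr (_ *: _).
have -> : P (srefl a (srefl b d)).
  by rewrite /P er !pairingDl !pairingZl !hz da db !mulr0 addr0 eqxx.
move=> /(_ isT); rewrite /f er.
have -> : (root d + 2 *: (root a - root b)) 0 j
        = (root d) 0 j + 2 * (root a - root b) 0 j by rewrite mxE [X in _ + X]mxE.
have : 0 < (root a - root b) 0 j ^+ 2 by rewrite exprn_even_gt0.
by move: ((root a - root b) 0 j) ((root d) 0 j) => e f'; nia.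
Qed.

(** By Cauchy-Schwarz the product of the two positive pairings is at most 4. If neither is 1, both
    are 2 and the roots coincide; if one is 1, the corresponding reflection yields the
    difference. *)
Lemma root_sub a b : 0 < <<root a, coroot b>> -> a != b ->
  root (srefl b a) = root a - root b \/ root (oppD (srefl a b)) = root a - root b.
Proof.
move=> hab ne; have hba := pairing_gt0C hab.
have [h1|h1] := eqVneq <<root a, coroot b>> 1.
  by left; rewrite root_srefl mul_refl h1 scale1r.
have [h2|h2] := eqVneq <<root b, coroot a>> 1.
  by right; rewrite root_oppD root_srefl mul_refl h2 scale1r opprB.
suff : a = b by move/eqP; rewrite (negPf ne).
have cs := rform_cauchy (root a) (root b).
have e1 := rform_root (root a) b; have e2 := rform_root (root b) a.
have pa := rform_root_gt0 a; have pb := rform_root_gt0 b.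
rewrite (rformC (root b)) in e2.
set x := <<root a, coroot b>> in hab h1 e1 *; set y := <<root b, coroot a>> in hba h2 e2 *.
have hxy : x * y <= 4.
  rewrite -(ler_pM2l (mulr_gt0 pa pb)).
  move: cs e1 e2; rewrite -/x -/y.
  move: (rform _ _) (rform (root a) (root a)) (rform (root b) (root b)) => C A B.
  move=> cs e1 e2; have : (2 * C) * (2 * C) = (B * x) * (A * y) by rewrite {1}e1 e2.
  nia.
by apply: root_pairing2; rewrite -/x -/y; nia.
Qed.

End RootDatum.

(** * The action of the Weyl group on roots *)

Section WeylAction.
Variables (n : nat) (D : rootDatum n).
Implicit Types (a b c d : D) (u v : 'M[int]_n) (J : {set D}) (s : seq D).

Lemma refl_prod_cons a s : refl_prod (a :: s) = refl a *m refl_prod s.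
Proof. by rewrite /refl_prod big_cons. Qed.

Lemma refl_prod_cat s1 s2 : refl_prod (s1 ++ s2) = refl_prod s1 *m refl_prod s2.
Proof.
elim: s1 => [|a s1 IH]; first by rewrite /refl_prod big_nil mul1mx.
by rewrite cat_cons !refl_prod_cons IH mulmxA.
Qed.

Lemma refl_prod1 a : refl_prod [:: a] = refl a.
Proof. by rewrite refl_prod_cons /refl_prod big_nil mulmx1. Qed.

Lemma in_W_1 J : in_W_ J 1%:M.
Proof. by exists [::]; rewrite // /refl_prod big_nil. Qed.

Lemma in_W_refl J a : a \in J -> in_W_ J (refl a).
Proof. by move=> aJ; exists [:: a]; rewrite ?refl_prod1 // => b /[1!inE] /eqP ->. Qed.

Lemma in_W_mul J u v : in_W_ J u -> in_W_ J v -> in_W_ J (u *m v).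
Proof.
move=> [s1 h1 ->] [s2 h2 ->]; exists (s1 ++ s2); rewrite ?refl_prod_cat //.
by move=> a; rewrite mem_cat => /orP [/h1|/h2].
Qed.

Lemma in_W_ind J (P : 'M[int]_n -> Prop) :
  P 1%:M ->
  (forall a u, a \in J -> in_W_ J u -> P u -> P (refl a *m u)) ->
  forall u, in_W_ J u -> P u.
Proof.
move=> P1 PS _ [s h ->]; elim: s h => [|a s IH] h.
  by rewrite /refl_prod big_nil.
have hs : {subset s <= J} by move=> b bs; apply: h; rewrite inE bs orbT.
by rewrite refl_prod_cons; apply: PS (IH hs); [apply: h; rewrite mem_head | exists s].
Qed.

Lemma in_W_unit J u : in_W_ J u -> u \in unitmx.
Proof.
elim/(@in_W_ind J) => [|a v _ _ hv]; first exact: unitmx1.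
by rewrite unitmx_mul refl_unit.
Qed.

Lemma invmxM u v : u \in unitmx -> v \in unitmx ->
  invmx (u *m v) = invmx v *m invmx u.
Proof.
move=> hu hv; have h : u *m v \in unitmx by rewrite unitmx_mul hu.
rewrite -[RHS]mulmx1 -(mulmxV h) !mulmxA -(mulmxA (invmx v)) (mulVmx hu).
by rewrite mulmx1 (mulVmx hv) mul1mx.
Qed.

Lemma in_W_inv J u : in_W_ J u -> in_W_ J (invmx u).
Proof.
elim/(@in_W_ind J) => [|a v aJ hv hi]; first by rewrite invmx1; exact: in_W_1.
rewrite invmxM ?refl_unit ?(in_W_unit hv) // invmx_refl.
exact: in_W_mul (in_W_refl aJ).
Qed.

Lemma in_W_sub J (K : {set D}) u : J \subset K -> in_W_ J u -> in_W_ K u.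
Proof. by move=> /fintype.subsetP JK [s h ->]; exists s => // a /h /JK. Qed.

Lemma in_W_full J u : in_W_ J u -> in_W D u.
Proof. by apply: in_W_sub; rewrite finset.subsetT. Qed.

(** Characters are rows acted on from the right, so the left action of [u] on roots is by the
    inverse matrix. *)
Definition wact u b : D := odflt b [pick c | root c == root b *m invmx u].

Lemma root_wact u b : in_W D u -> root (wact u b) = root b *m invmx u.
Proof.
move=> hu; rewrite /wact; case: pickP => [c /eqP //|no].
suff [c hc] : exists c, root c = root b *m invmx u by have := no c; rewrite hc eqxx.
elim/in_W_ind: hu b {no} => [b|a v _ hv IH b].
  by exists b; rewrite invmx1 mulmx1.
have [c hc] := IH b.
rewrite invmxM ?refl_unit ?(in_W_unit hv) // invmx_refl mulmxA -hc.
by exists (srefl a c); rewrite root_srefl.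
Qed.

Lemma wact1 b : wact 1%:M b = b.
Proof. by apply: root_inj; rewrite root_wact ?invmx1 ?mulmx1 //; exact: in_W_1. Qed.

Lemma wactM u v b : in_W D u -> in_W D v -> wact (u *m v) b = wact u (wact v b).
Proof.
move=> hu hv; apply: root_inj; rewrite !root_wact //; last exact: in_W_mul.
by rewrite invmxM ?(in_W_unit hu) ?(in_W_unit hv) // mulmxA.
Qed.

Lemma in_WT_refl a : in_W D (refl a).
Proof. by apply: in_W_refl; rewrite finset.in_setT. Qed.

Lemma wact_refl a b : wact (refl a) b = srefl a b.
Proof.
by apply: root_inj; rewrite root_wact ?invmx_refl ?root_srefl //; exact: in_WT_refl.
Qed.

Lemma wactK u : in_W D u -> cancel (wact u) (wact (invmx u)).
Proof.
move=> hu b; rewrite -wactM //; last exact: in_W_inv.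
by rewrite mulVmx ?wact1 ?(in_W_unit hu).
Qed.

Lemma wactVK u : in_W D u -> cancel (wact (invmx u)) (wact u).
Proof.
move=> hu b; rewrite -wactM //; last exact: in_W_inv.
by rewrite mulmxV ?wact1 ?(in_W_unit hu).
Qed.

Lemma wact_inj u : in_W D u -> injective (wact u).
Proof. by move=> hu; apply: can_inj (wactK hu). Qed.

Lemma wact_oppD u b : in_W D u -> wact u (oppD b) = oppD (wact u b).
Proof.
move=> hu; apply: root_inj.
by rewrite (root_wact _ hu) (root_oppD b) mulNmx root_oppD (root_wact _ hu).
Qed.

Lemma coroot_wact u b : in_W D u -> coroot (wact u b) = u *m coroot b.
Proof.
elim/in_W_ind => [|a v _ hv IH]; first by rewrite wact1 mul1mx.
rewrite (wactM _ (in_WT_refl a) hv) wact_refl coroot_srefl IH.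
exact: mulmxA.
Qed.

Lemma refl_wact u b : in_W D u -> refl (wact u b) = u *m refl b *m invmx u.
Proof.
move=> hu; rewrite /refl (coroot_wact _ hu) (root_wact _ hu).
by rewrite mulmxBr mulmx1 mulmxBl (mulmxV (in_W_unit hu)) !mulmxA.
Qed.

Lemma root_subsystemT : root_subsystem [set: D].
Proof.
apply/forallP => a; apply/implyP => _; apply/forallP => b.
rewrite finset.in_setT eq_sym; apply/eqP; apply/existsP; exists (srefl a b).
by rewrite finset.in_setT -root_srefl sreflK eqxx.
Qed.

Section Subsystem.
Variables (J : {set D}) (hJ : root_subsystem J).

Lemma srefl_in a b : a \in J -> (srefl a b \in J) = (b \in J).
Proof.
move=> aJ.
have stab c : c \in J -> srefl a c \in J.
  move=> cJ; have /forallP/(_ a)/implyP/(_ aJ)/forallP/(_ (srefl a c))/eqP -> := hJ.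
  by apply/existsP; exists c; rewrite cJ root_srefl eqxx.
by apply/idP/idP => [/stab|/stab //]; rewrite sreflK.
Qed.

Lemma oppD_in a : (oppD a \in J) = (a \in J).
Proof.
apply/idP/idP => h; last by rewrite srefl_in.
by rewrite -(oppDK a) srefl_in.
Qed.

Lemma wact_in u b : in_W_ J u -> (wact u b \in J) = (b \in J).
Proof.
elim/in_W_ind => [|a v aJ hv IH]; first by rewrite wact1.
by rewrite (wactM _ (in_WT_refl a) (in_W_full hv)) wact_refl (srefl_in _ aJ).
Qed.

End Subsystem.

End WeylAction.

(** * The group law of the extended affine Weyl group *)

Section ExtendedGroupTheory.
Variables (n : nat) (D : rootDatum n).
Implicit Types (x y z : ext n) (J : {set D}).

Lemma emulA : associative (@emul n).
Proof.
by move=> x y z; rewrite /emul /=; congr (_, _); rewrite ?mulmxDr ?mulmxA ?addrA.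
Qed.

Lemma emul1x : left_id (eone n) (@emul n).
Proof. by case=> l u; rewrite /emul /eone /= !mul1mx add0r. Qed.

Lemma emulx1 : right_id (eone n) (@emul n).
Proof. by case=> l u; rewrite /emul /eone /= mulmx0 mulmx1 addr0. Qed.

Lemma emulVx x : x.2 \in unitmx -> emul (einv x) x = eone n.
Proof. by move=> h; rewrite /emul /einv /eone /= mulVmx // addNr. Qed.

Lemma emulxV x : x.2 \in unitmx -> emul x (einv x) = eone n.
Proof.
by move=> h; rewrite /emul /einv /eone /= mulmxN mulmxA mulmxV // mul1mx addrN.
Qed.

Lemma in_Wext1 J : in_Wext J (eone n).
Proof. exact: in_W_1. Qed.

Lemma in_Wext_mul J x y : in_Wext J x -> in_Wext J y -> in_Wext J (emul x y).
Proof. exact: in_W_mul. Qed.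

Lemma in_Wext_inv J x : in_Wext J x -> in_Wext J (einv x).
Proof. exact: in_W_inv. Qed.

Lemma in_Wext_unit J x : in_Wext J x -> x.2 \in unitmx.
Proof. exact: in_W_unit. Qed.

Lemma in_Wext_aff_refl J (a : affroot D) : a.1 \in J -> in_Wext J (aff_refl a).
Proof. exact: in_W_refl. Qed.

Lemma einvK J x : in_Wext J x -> einv (einv x) = x.
Proof.
move=> h; have hu := in_Wext_unit h.
rewrite /einv /= invmxK; case: x h hu => l u /= _ hu.
by rewrite mulmxN opprK mulmxA mulmxV // mul1mx.
Qed.

Lemma einv_uniq J x y : in_Wext J x -> emul x y = eone n -> y = einv x.
Proof.
move=> hx h; rewrite -(emul1x y) -(emulVx (in_Wext_unit hx)) -emulA h.
exact: emulx1.
Qed.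

Lemma einvM J x y : in_Wext J x -> in_Wext J y ->
  einv (emul x y) = emul (einv y) (einv x).
Proof.
move=> hx hy; apply/esym/(einv_uniq (in_Wext_mul hx hy)).
rewrite emulA -(emulA x) (emulxV (in_Wext_unit hy)) emulx1.
exact: emulxV (in_Wext_unit hx).
Qed.

Lemma aff_reflK (a : affroot D) : emul (aff_refl a) (aff_refl a) = eone n.
Proof.
rewrite /emul /aff_refl /eone /= reflK mulmxN -scalemxAr refl_mul_coroot.
by rewrite scalerN opprK addNr.
Qed.

Lemma einv_aff_refl (a : affroot D) : einv (aff_refl a) = aff_refl a.
Proof.
apply/esym/(@einv_uniq [set: D]); last exact: aff_reflK.
by apply: in_Wext_aff_refl; rewrite finset.in_setT.
Qed.

End ExtendedGroupTheory.

(** * Positive and simple affine roots *)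

Section Positivity.
Variables (n : nat) (D : rootDatum n).
Implicit Types (a b c d : D) (u v : 'M[int]_n) (J : {set D}).
Implicit Types (e f g : affroot D) (s : seq (affroot D)).

Definition gen_cochar : 'cV[int]_n := projT1 (cid (posroots_generic D)).

(** Not the sum of coefficients on simple roots, but the value at a fixed regular cocharacter
    defining the positive system. *)
Definition ht a : int := pairing (root a) gen_cochar.

Lemma ht_neq0 a : ht a != 0.
Proof. by rewrite /ht /gen_cochar; case: cid => x /= /(_ a) []. Qed.

Lemma posroots_ht a : (a \in posroots D) = (0 < ht a).
Proof. by rewrite /ht /gen_cochar; case: cid => x /= /(_ a) []. Qed.

Lemma ht_oppD a : ht (oppD a) = - ht a.
Proof. by rewrite /ht root_oppD pairingNl. Qed.

Lemma posroots_oppD a : (oppD a \in posroots D) = (a \notin posroots D).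
Proof.
rewrite !posroots_ht ht_oppD oppr_gt0 -leNgt le_eqVlt.
by rewrite (negPf (ht_neq0 a)).
Qed.

(** The least [k] for which the affine root [a + k] is positive on the base alcove. *)
Definition isneg a : int := (a \notin posroots D)%:Z.

Lemma isneg_oppD a : isneg (oppD a) = 1 - isneg a.
Proof. by rewrite /isneg posroots_oppD negbK; case: (_ \in _). Qed.

Lemma isneg01 a : 0 <= isneg a <= 1.
Proof. by rewrite /isneg; case: (_ \in _). Qed.

Definition apos e : bool := isneg e.1 <= e.2.

Definition aopp e : affroot D := (oppD e.1, - e.2).

Lemma apos_opp e : apos (aopp e) = ~~ apos e.
Proof. by rewrite /apos /= isneg_oppD -ltNge; lia. Qed.

Lemma apos0 a : apos (a, 0) = (a \in posroots D).
Proof. by rewrite /apos /isneg /=; case: (_ \in _). Qed.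

(** Larger than every [ht a] in absolute value, so that [gen_cochar] divided by it lies in the base
    alcove. *)
Definition ht_bound : int := 1 + \sum_(a : D) `|ht a|.

Lemma ht_boundP a : `|ht a| < ht_bound.
Proof.
rewrite /ht_bound (bigD1 a) //=.
have : 0 <= \sum_(i | i != a) `|ht i| :> int by apply: sumr_ge0.
by rewrite addrCA ltrDl addrC => ?; apply: ltr_wpDl.
Qed.

(* A value of the affine root at an (integrally rescaled) point of the base
   alcove. *)
Definition aht e : int := ht e.1 + e.2 * ht_bound.

Lemma apos_aht e : apos e = (0 < aht e).
Proof.
rewrite /apos /aht /isneg posroots_ht.
have := ht_boundP e.1; have := ht_neq0 e.1.
move: (ht e.1) ht_bound e.2 => h M k h0 hM.
case: ltP => /= hh; nia.
Qed.

Definition is_sum e s : Prop :=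
  root e.1 = \sum_(f <- s) root f.1 /\ e.2 = \sum_(f <- s) f.2.

Lemma aht_sum e s : is_sum e s -> aht e = \sum_(f <- s) aht f.
Proof.
case=> h1 h2; rewrite /aht /ht h1 h2 pairing_suml mulr_suml -big_split.
by [].
Qed.

Section Eval.
Variable R : rcfType.
Implicit Types z : 'cV[R]_n.

Lemma pairing_map (chi : 'rV[int]_n) (x : 'cV[int]_n) :
  pairing (map_mx intr chi) (map_mx intr x) = (pairing chi x)%:~R :> R.
Proof. by rewrite /pairing -map_mxM mxE. Qed.

Lemma root_map_oppD a z :
  pairing (map_mx intr (root (oppD a))) z = - pairing (map_mx intr (root a)) z.
Proof. by rewrite root_oppD map_mxN pairingNl. Qed.

Lemma base_alcove_point :
  base_alcove D (ht_bound%:~R^-1 *: map_mx intr gen_cochar : 'cV[R]_n).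
Proof.
move=> a ap; rewrite pairingZr pairing_map -/(ht a).
have h := ht_boundP a; rewrite posroots_ht in ap.
have M0 : 0 < ht_bound by move: (ht_bound) (ht a) ap h => M k; lia.
have M0' : 0 < ht_bound%:~R :> R by rewrite ltr0z.
rewrite mulrC divr_gt0 ?ltr0z //= ltr_pdivrMr // mul1r ltr_int.
by move: (ht_bound) (ht a) ap h => M k; lia.
Qed.

Lemma base_alcove_root z a : base_alcove D z ->
  - (isneg a)%:~R < pairing (map_mx intr (root a)) z < 1 - (isneg a)%:~R.
Proof.
move=> hz; rewrite /isneg; case: (boolP (a \in _)) => ha /=.
  by rewrite mulr0z oppr0 addr0; exact: hz.
have := hz (oppD a); rewrite posroots_oppD => /(_ ha).
rewrite root_map_oppD oppr_gt0 ltrNl => /andP [h1 h2].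
by rewrite h2 subrr.
Qed.

Lemma apos_eval e z : base_alcove D z -> apos e -> 0 < aff_eval e z.
Proof.
move=> /(base_alcove_root e.1) /andP [h1 _]; rewrite /apos -(ler_int R) => h2.
rewrite /aff_eval; lra.
Qed.

Lemma aff_eval_opp e z : aff_eval (aopp e) z = - aff_eval e z.
Proof. by rewrite /aff_eval /= root_map_oppD rmorphN opprD. Qed.

Lemma aff_posP e : aff_pos R e <-> apos e.
Proof.
split=> [h|h z hz]; last exact: apos_eval.
apply/negPn/negP; rewrite -apos_opp => h'.
have := apos_eval base_alcove_point h'; rewrite aff_eval_opp.
have := h _ base_alcove_point; lra.
Qed.

Lemma aff_eval0 e : aff_eval e (0 : 'cV[R]_n) = e.2%:~R.
Proof. by rewrite /aff_eval pairing0r add0r. Qed.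

(** The constant terms are compared at the origin, then the gradients at the vectors of the standard
    basis. *)
Lemma aff_eval_sumP e s :
  (forall z, aff_eval e z = \sum_(f <- s) aff_eval f z) <-> is_sum e s.
Proof.
split=> [h|[h1 h2] z]; last first.
  by rewrite /aff_eval h1 h2 map_mx_sum pairing_suml rmorph_sum -big_split.
have h2 : e.2 = \sum_(f <- s) f.2.
  apply: (@intr_inj R); rewrite -aff_eval0 h rmorph_sum.
  by apply: eq_bigr => f _; exact: aff_eval0.
split=> //; apply/rowP => i; apply: (@intr_inj R).
have := h (delta_mx i 0); rewrite /aff_eval big_split /= -rmorph_sum -h2.
move=> /addIr; rewrite -pairing_suml -map_mx_sum /pairing.
by rewrite -!colE !mxE.
Qed.

End Eval.

Definition asimple J e : Prop :=
  [/\ e.1 \in J, apos e &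
    forall s, (1 < size s)%N -> (forall f, f \in s -> f.1 \in J /\ apos f) ->
      ~ is_sum e s].

Lemma aff_simpleP (R : rcfType) J e : aff_simple R J e <-> asimple J e.
Proof.
split=> [[[h1 /aff_posP h2] h3]|[h1 h2 h3]].
  split=> // s hs hp he; apply: h3; exists s; split=> //; last exact/aff_eval_sumP.
  by move=> f /hp [fJ /(aff_posP R)].
split; first by split=> //; exact/aff_posP.
case=> s [hs hp /aff_eval_sumP he]; apply: (h3 s) => // f /hp [fJ hf].
by split=> //; exact/(aff_posP R).
Qed.

Lemma is_sum_flatten e s (F : affroot D -> seq (affroot D)) :
  is_sum e s -> (forall f, f \in s -> is_sum f (F f)) ->
  is_sum e (flatten [seq F f | f <- s]).
Proof.
move=> [h1 h2] hF; split.
  rewrite h1 big_flatten /= big_map big_seq [RHS]big_seq; apply: eq_bigr => f fs.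
  by case: (hF f fs).
rewrite h2 big_flatten /= big_map big_seq [RHS]big_seq; apply: eq_bigr => f fs.
by case: (hF f fs).
Qed.

(** Induction on the positive integer [aht e]: in a sum of at least two positive affine roots every
    term has a smaller value. *)
Lemma pos_decomp J e : e.1 \in J -> apos e ->
  exists2 s, forall f, f \in s -> asimple J f & is_sum e s.
Proof.
have [k] := ubnP `|aht e|%N; elim: k e => // k IH e hk eJ epos.
have [es|nes] := pselect (asimple J e).
  by exists [:: e]; [move=> f /[1!inE] /eqP -> | split; rewrite big_seq1].
have [s [hs hp he]] : exists s, [/\ (1 < size s)%N,
    forall f, f \in s -> f.1 \in J /\ apos f & is_sum e s].
  apply: contrapT => no; apply: nes; split=> // s hs hp he.
  by apply: no; exists s.
have lt f : f \in s -> (`|aht f| < k)%N.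
  move=> fs; have := aht_sum he; rewrite (big_rem f) //=.
  have : 0 < \sum_(g <- rem f s) aht g.
    have hr g : g \in rem f s -> 0 < aht g.
      by move=> /mem_rem /hp []; rewrite apos_aht.
    have : (0 < size (rem f s))%N by rewrite size_rem // -subn1 subn_gt0.
    case: (rem f s) hr => // g t hr _; rewrite big_cons ltr_wpDr //.
      by rewrite big_seq; apply: sumr_ge0 => i it; rewrite ltW // hr // inE it orbT.
    by rewrite hr // mem_head.
  have [_] := hp f fs; rewrite apos_aht.
  by move: hk; move: (\sum_(g <- _) _) (aht e) (aht f) => x y z; lia.
have /choice [F hF] : forall f, exists t, f \in s ->
    (forall g, g \in t -> asimple J g) /\ is_sum f t.
  move=> f; have [fs|] := boolP (f \in s); last by exists [::].
  have [fJ fp] := hp f fs; have [t h1 h2] := IH f (lt f fs) fJ fp.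
  by exists t.
exists (flatten [seq F f | f <- s]).
  by move=> g /flattenP [_ /mapP [f fs ->]]; case: (hF f fs) => h _ /h.
by apply: is_sum_flatten he _ => f /hF [].
Qed.

(** A positive [a + k] of higher level is the sum of [a + isneg a], [a + (k - 1)] and
    [- a + (1 - isneg a)], all positive. *)
Lemma asimple_level J e : root_subsystem J -> asimple J e -> e.2 = isneg e.1.
Proof.
move=> hJ [eJ ep es]; apply/eqP; apply: contraT => ne.
case: (es [:: (e.1, isneg e.1); (e.1, e.2 - 1); (oppD e.1, 1 - isneg e.1)]) => //.
  move: ep; rewrite /apos le_eqVlt eq_sym (negPf ne) /= => lt.
  move=> f; rewrite !inE => /or3P [] /eqP -> /=; rewrite /apos /=; split => //.
  - by move: lt; move: (isneg _) => i; lia.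
  - by rewrite oppD_in.
  - by rewrite isneg_oppD.
split; rewrite !big_cons big_nil /= ?root_oppD addr0; last by ring.
by rewrite subrr addr0.
Qed.

(** With a positive pairing, the difference would be an affine root; it or its opposite is positive,
    which decomposes [f] or [e]. Equal gradients are excluded since they force equal levels. *)
Lemma asimple_obtuse J e f : root_subsystem J ->
  asimple J e -> asimple J f -> e != f ->
  pairing (root f.1) (coroot e.1) <= 0.
Proof.
move=> hJ he hf ne; rewrite leNgt; apply/negP => hp.
have [eq1|ne1] := eqVneq f.1 e.1.
  move/eqP: ne; apply; move: eq1 (asimple_level hJ he) (asimple_level hJ hf).
  by case: e f {he hf hp} => [a k] [b l] /= -> -> ->.
have [eJ ep es] := he; have [fJ fp fs] := hf.
have [c cJ hc] : exists2 c, c \in J & root c = root f.1 - root e.1.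
  case: (root_sub hp ne1) => h; [exists (srefl e.1 f.1) | exists (oppD (srefl f.1 e.1))] => //.
    by rewrite srefl_in.
  by rewrite oppD_in // srefl_in.
have [gp|] := boolP (apos (c, f.2 - e.2)).
  apply: (fs [:: e; (c, f.2 - e.2)]) => //.
    by move=> g; rewrite !inE => /orP [] /eqP ->.
  by split; rewrite !big_cons big_nil /= addr0 ?hc addrC ?subrK.
rewrite -apos_opp => gp; apply: (es [:: f; aopp (c, f.2 - e.2)]) => //.
  by move=> g; rewrite !inE => /orP [] /eqP -> //=; rewrite oppD_in.
by split; rewrite !big_cons big_nil /= addr0 ?root_oppD ?hc opprB addrC ?subrK.
Qed.

(** The factor [k] divides the pairing 2 of [b] with its coroot, and [k = 2] is excluded by
    reducedness. *)
Lemma root_mult (k : nat) a b : root b = root a *+ k -> b = a.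
Proof.
move=> h; have := pairing_root_coroot b; rewrite h -scaler_nat pairingZl.
case: k h => [|[|[|k]]] h.
- by rewrite mul0r.
- by move=> _; apply: root_inj; rewrite h mulr1n.
- by move: h; rewrite -scaler_nat => /root_reduced.
- by rewrite natz; move: (pairing _ _) => x; clear; move=> e; exfalso; case: (lerP x 0) => hx; nia.
Qed.

Definition arefl e f : affroot D :=
  (srefl e.1 f.1, f.2 - pairing (root f.1) (coroot e.1) * e.2).

(** If both [f] and the opposite of [s_e f] were positive, decomposing them into simple roots would
    write [N e] as a sum of simple roots, where [N] is the pairing of [f] with the coroot of [e].
    Only [e] can occur in that sum, whence [f = e]. *)
Lemma arefl_pos J e f : root_subsystem J -> asimple J e ->
  f.1 \in J -> apos f -> f != e -> apos (arefl e f).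
Proof.
move=> hJ he fJ fp ne; have [eJ ep _] := he.
rewrite -[apos _]negbK -apos_opp; apply/negP => gp.
have [s1 hs1 e1] := pos_decomp fJ fp.
have gJ : (aopp (arefl e f)).1 \in J by rewrite /= oppD_in // srefl_in.
have [s2 hs2 e2] := pos_decomp gJ gp.
set N := pairing (root f.1) (coroot e.1).
have hs g : g \in s1 ++ s2 -> asimple J g by rewrite mem_cat => /orP [/hs1|/hs2].
have eN : N * aht e = \sum_(g <- s1 ++ s2) aht g.
  rewrite big_cat -(aht_sum e1) -(aht_sum e2) /= /aht /= ht_oppD.
  rewrite /ht root_srefl mul_refl -/N pairingDl pairingNl pairingZl; ring.
have eP : N * 2 = \sum_(g <- s1 ++ s2) pairing (root g.1) (coroot e.1).
  rewrite big_cat /= -!pairing_suml; case: e1 => <- _; case: e2 => <- _ /=.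
  rewrite root_oppD root_srefl pairingNl pairing_mulmx refl_mul_coroot pairingNr.
  by rewrite opprK -/N mulr2n mulrDr mulr1.
set m : int := \sum_(g <- s1 ++ s2 | g == e) 1.
have split_sum (G : affroot D -> int) : \sum_(g <- s1 ++ s2) G g =
    G e * m + \sum_(g <- s1 ++ s2 | g != e) G g.
  rewrite (bigID (pred1 e)) /= mulr_sumr; congr (_ + _).
  by apply: eq_bigr => g /eqP ->; rewrite mulr1.
rewrite split_sum in eN; rewrite split_sum pairing_root_coroot in eP.
have h1 : \sum_(g <- s1 ++ s2 | g != e) pairing (root g.1) (coroot e.1) <= 0.
  rewrite big_seq_cond; apply: sumr_le0 => g /andP [/hs hg ge].
  by apply: asimple_obtuse hJ he hg _; rewrite eq_sym.
have e0 : 0 < aht e by rewrite -apos_aht.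
have h2 g : g \in s1 ++ s2 -> 0 < aht g.
  by move=> /hs [_ + _]; rewrite apos_aht.
(* Pairing with the coroot of [e] gives [N <= m] by obtuseness, so the copies of [e] already exhaust
   the value of [N e]. *)
have h3 : \sum_(g <- s1 ++ s2 | g != e) aht g <= 0.
  by move: h1 eN eP; move: (\sum_(_ <- _ | _) aht _) (\sum_(_ <- _ | _) pairing _ _); nia.
have h4 : all (pred1 e) s1.
  apply/allP => g gs /=; apply: contraT => ge; move: h3; rewrite leNgt => /negP [].
  have gs' : g \in s1 ++ s2 by rewrite mem_cat gs.
  rewrite (big_rem g) //= ge ltr_wpDr ?h2 // big_seq_cond.
  by apply: sumr_ge0 => k /andP [/mem_rem /h2 /ltW].
have [k es1] : exists k, s1 = nseq k e by exists (size s1); apply/all_pred1P.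
have [r1 r2] := e1; rewrite es1 !big_nseq !iter_addr_0 in r1 r2.
have fe := root_mult r1.
have k1 : k = 1%N.
  have := congr1 (fun chi => pairing chi (coroot e.1)) r1.
  rewrite fe -scaler_nat pairingZl natz pairing_root_coroot.
  clear; lia.
move: r2 fe ne; rewrite k1 mulr1n; case: (e) (f) => [a x] [b y] /= -> ->.
by rewrite eqxx.
Qed.

End Positivity.

(** * Inversions in the extended affine Weyl group *)

Lemma least_eq (P : nat -> Prop) k :
  P k -> (forall m, P m -> (k <= m)%N) -> least P = k.
Proof.
move=> Pk min; rewrite /least; case: xgetP => [j _ [Pj jmin]|/(_ k) []] //.
by apply/eqP; rewrite eqn_leq jmin // min.
Qed.

Section AffineAction.
Variables (n : nat) (D : rootDatum n).
Implicit Types (a b c d : D) (u v : 'M[int]_n) (J : {set D}).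
Implicit Types (e f g : affroot D) (s : seq (affroot D)) (x y : ext n).

(** The action on affine functions by transport: the value of [eacta x e] at [x z] is that of [e] at
    [z]. *)
Definition eacta x e : affroot D :=
  (wact x.2 e.1, e.2 - pairing (root (wact x.2 e.1)) x.1).

Lemma eactaM J x y e : in_Wext J x -> in_Wext J y ->
  eacta (emul x y) e = eacta x (eacta y e) :> (D * int).
Proof.
move=> /in_W_full hx /in_W_full hy; rewrite /eacta /= wactM //; congr (_, _).
rewrite pairingDr (root_wact (wact y.2 e.1) hx) -pairing_mulmx -mulmxA.
by rewrite (mulVmx (in_W_unit hx)) mulmx1 opprD addrCA addrC.
Qed.

Lemma eacta1 e : eacta (eone n) e = e :> (D * int).
Proof. by case: e => a k; rewrite /eacta /= wact1 pairing0r subr0. Qed.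

Lemma eactaVK J x e : in_Wext J x -> eacta x (eacta (einv x) e) = e :> (D * int).
Proof.
move=> hx; rewrite -(eactaM _ hx (in_Wext_inv hx)).
by rewrite (emulxV (in_Wext_unit hx)) eacta1.
Qed.

Lemma eacta_refl e f : eacta (aff_refl e) f = arefl e f :> (D * int).
Proof.
rewrite /eacta /arefl /= wact_refl; congr (_, _).
rewrite pairingNr pairingZr opprK root_srefl pairing_mulmx refl_mul_coroot pairingNr.
by rewrite mulrN mulrC.
Qed.

Lemma eacta_opp J x e : in_Wext J x -> eacta x (aopp e) = aopp (eacta x e) :> (D * int).
Proof.
move=> /in_W_full hx; rewrite /eacta /aopp /= (wact_oppD _ hx); congr (_, _).
by rewrite root_oppD pairingNl opprK opprB addrC.
Qed.

Lemma is_sum_eacta J x e s : in_Wext J x -> is_sum e s -> is_sum (eacta x e) (map (eacta x) s).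
Proof.
move=> /in_W_full hx [h1 h2]; split; rewrite big_map.
  by rewrite root_wact // h1 mulmx_suml; apply: eq_bigr => f _; rewrite root_wact.
rewrite /= root_wact // h1 h2 mulmx_suml pairing_suml -sumrB.
by apply: eq_bigr => f _; rewrite root_wact.
Qed.

Lemma eacta_in J x e : root_subsystem J -> in_Wext J x -> ((eacta x e).1 \in J) = (e.1 \in J).
Proof. by move=> hJ hx; rewrite /= wact_in. Qed.

(* [shift x a] is the number of positive affine roots of direction [a] that
   [x] makes negative, or minus the number of those of direction [- a]. *)
Definition shift x a : int :=
  pairing (root (wact x.2 a)) x.1 + isneg (wact x.2 a) - isneg a.

Lemma apos_eacta x e : apos (eacta x e) = (shift x e.1 <= e.2 - isneg e.1).
Proof.
rewrite /apos /shift /=; move: (pairing _ _) (isneg _) (isneg _) => p i j; lia.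
Qed.

Lemma shiftM J x y a : in_Wext J x -> in_Wext J y ->
  shift (emul x y) a = shift y a + shift x (wact y.2 a).
Proof.
move=> hx hy; have := eactaM (a, 0) hx hy.
case=> h1 h2; rewrite /shift h1 /=; move: h2.
by rewrite (wactM _ (in_W_full hx) (in_W_full hy)) /=; lia.
Qed.

Lemma shift1 a : shift (eone n) a = 0.
Proof. by rewrite /shift wact1 pairing0r add0r subrr. Qed.

Lemma shift_opp J x a : in_Wext J x -> shift x (oppD a) = - shift x a.
Proof.
move=> /in_W_full hx; rewrite /shift (wact_oppD _ hx) root_oppD pairingNl (isneg_oppD a).
rewrite (isneg_oppD (wact _ _)); ring.
Qed.

(** Twice the number of positive affine roots of [J] made negative by [x], as [a] and [- a]
    contribute equally. *)
Definition inversions J x : nat := \sum_(a in J) `|shift x a|%N.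

Lemma shiftV J x a : in_Wext J x -> shift (einv x) (wact x.2 a) = - shift x a.
Proof.
move=> hx; have := shiftM a (in_Wext_inv hx) hx.
by rewrite (emulVx (in_Wext_unit hx)) shift1; lia.
Qed.

Lemma inversions0_apos J x e : inversions J x = 0%N -> e.1 \in J ->
  apos (eacta x e) = apos e.
Proof.
move=> /eqP; rewrite sum_nat_eq0 => /forall_inP h eJ; rewrite apos_eacta.
by have /eqP := h _ eJ; rewrite /apos; move: (isneg _) (shift _ _) => i t; lia.
Qed.

(** Positive affine roots have nonnegative levels. Hence finite root systems can be studied among
    the affine roots of level zero. *)
Lemma decomp_level0 a s : is_sum (a, 0) s -> (forall e, e \in s -> apos e) ->
  forall e, e \in s -> e.2 = 0.
Proof.
move=> [_ h] hs e es; have ge g : g \in s -> 0 <= g.2.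
  by move=> /hs; rewrite /apos; have := isneg01 g.1; lia.
move: h; rewrite /= (big_rem e) //=.
have : 0 <= \sum_(g <- rem e s) g.2.
  by rewrite big_seq; apply: sumr_ge0 => g /mem_rem /ge.
have := ge e es; move: (\sum_(_ <- _) _) => x; lia.
Qed.

Section Subsystem.
Variables (J : {set D}) (hJ : root_subsystem J).

Lemma big_wact u (F : D -> nat) : in_W_ J u ->
  (\sum_(a in J) F (wact u a) = \sum_(a in J) F a)%N.
Proof.
move=> hu; rewrite [RHS](reindex_inj (wact_inj (in_W_full hu))).
by apply: eq_bigl => a; rewrite wact_in.
Qed.

Lemma inversionsM_le x y : in_Wext J x -> in_Wext J y ->
  (inversions J (emul x y) <= inversions J x + inversions J y)%N.
Proof.
move=> hx hy; rewrite /inversions -(big_wact (fun a => `|shift x a|%N) hy) -big_split /=.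
by apply: leq_sum => a _; rewrite (shiftM _ hx hy); move: (shift _ _) (shift _ _) => p q; lia.
Qed.

(** In the cocycle identity [shiftM] the absolute values add up when the two terms have the same
    sign. *)
Lemma inversionsM x y : in_Wext J x -> in_Wext J y ->
  (forall a, a \in J -> 0 <= shift y a * shift x (wact y.2 a)) ->
  inversions J (emul x y) = (inversions J x + inversions J y)%N.
Proof.
move=> hx hy h; rewrite /inversions -(big_wact (fun a => `|shift x a|%N) hy) -big_split /=.
by apply: eq_bigr => a /h; rewrite (shiftM _ hx hy); move: (shift _ _) (shift _ _) => p q; nia.
Qed.

Lemma inversionsV x : in_Wext J x -> inversions J (einv x) = inversions J x.
Proof.
move=> hx; rewrite /inversions -(big_wact (fun a => `|shift (einv x) a|%N) hx).
by apply: eq_bigr => a _; rewrite (shiftV _ hx) abszN.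
Qed.

Lemma inversions_eq0 x : (forall a, a \in J -> shift x a <= 0) -> in_Wext J x ->
  inversions J x = 0%N.
Proof.
move=> h hx; apply: big1 => a aJ; have := h _ aJ; have := h (oppD a).
by rewrite oppD_in // aJ (shift_opp _ hx) => /(_ isT); lia.
Qed.

Lemma simple_apos x : in_Wext J x ->
  (forall e, asimple J e -> apos (eacta x e)) ->
  forall e, e.1 \in J -> apos e -> apos (eacta x e).
Proof.
move=> hx h e eJ ep; have [s hs es] := pos_decomp eJ ep.
rewrite apos_aht (aht_sum (is_sum_eacta hx es)) big_map.
have s0 : s != [::].
  apply/eqP => s0; move: ep; rewrite apos_aht (aht_sum es) s0 big_nil.
  by rewrite ltxx.
case: s hs {es} s0 => // f s hs _; rewrite big_cons ltr_wpDr //; last first.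
  by rewrite -apos_aht; apply/h/hs; rewrite mem_head.
rewrite big_seq; apply: sumr_ge0 => g gs; rewrite ltW // -apos_aht; apply/h/hs.
by rewrite inE gs orbT.
Qed.

Lemma simple_apos0 x : in_Wext J x ->
  (forall a, asimple J (a, 0) -> apos (eacta x (a, 0))) ->
  forall a, a \in J -> a \in posroots D -> apos (eacta x (a, 0)).
Proof.
move=> hx h a aJ ap.
have [s hs es] : exists2 s, forall f, f \in s -> asimple J f & is_sum (a, 0) s.
  by apply: pos_decomp => //; rewrite apos0.
have h0 := decomp_level0 es (fun e es => let: And3 _ p _ := hs e es in p).
rewrite apos_aht (aht_sum (is_sum_eacta hx es)) big_map.
have s0 : s != [::].
  apply/eqP => s0; move: ap; rewrite -apos0 apos_aht (aht_sum es) s0 big_nil.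
  by rewrite ltxx.
have hh f : f \in s -> 0 < aht (eacta x f).
  move=> fs; have := hs f fs; have := h0 f fs; case: f {fs} => b k /= ->.
  by rewrite -apos_aht; apply: h.
case: s hs es h0 hh s0 => // f s hs es h0 hh _; rewrite big_cons ltr_wpDr //; last first.
  by apply: hh; rewrite mem_head.
by rewrite big_seq; apply: sumr_ge0 => g gs; rewrite ltW // hh // inE gs orbT.
Qed.

Section Simple.
Variables (e : affroot D) (he : asimple J e).

Let eJ : e.1 \in J. Proof. by case: he. Qed.

Lemma in_Wext_simple : in_Wext J (aff_refl e).
Proof. exact: in_Wext_aff_refl. Qed.

Lemma shift_simple1 : shift (aff_refl e) e.1 = 1.
Proof.
rewrite /shift /= wact_refl -/(oppD _) isneg_oppD root_oppD pairingNl pairingNr.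
rewrite opprK pairingZr pairing_root_coroot (asimple_level hJ he); ring.
Qed.

Lemma shift_simple0 a : a \in J -> a != e.1 -> a != oppD e.1 ->
  shift (aff_refl e) a = 0.
Proof.
move=> aJ ne1 ne2.
have key b : b \in J -> b != e.1 -> shift (aff_refl e) b <= 0.
  move=> bJ ne; have := @arefl_pos _ _ J e (b, isneg b) hJ he bJ.
  rewrite -eacta_refl apos_eacta subrr; apply; first by rewrite /apos.
  by apply: contra ne => /eqP <-.
apply/eqP; rewrite eq_le key //=.
have := key (oppD a); rewrite oppD_in // aJ (shift_opp _ in_Wext_simple) oppr_le0.
by apply=> //; apply: contra ne2 => /eqP <-; rewrite oppDK.
Qed.

Lemma inversions_simple : inversions J (aff_refl e) = 2.
Proof.
have ne : oppD e.1 != e.1.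
  apply/eqP => h; have := posroots_oppD e.1; rewrite h; case: (_ \in _) => //.
rewrite /inversions (bigD1 e.1) //= shift_simple1 (bigD1 (oppD e.1)) /=; last first.
  by rewrite oppD_in // eJ.
rewrite (shift_opp _ in_Wext_simple) shift_simple1 big1 // => a /andP [/andP [aJ h1] h2].
by rewrite shift_simple0.
Qed.

(** The shift of a simple reflection is supported on the two directions of its root, so the sign
    condition of [inversionsM] concerns only the preimages of these. *)
Lemma inversions_simple_mul x : in_Wext J x -> apos (eacta (einv x) e) ->
  inversions J (emul (aff_refl e) x) = (inversions J x).+2.
Proof.
move=> hx hp; rewrite inversionsM ?inversions_simple ?add2n //; first exact: in_Wext_simple.
have key a : a \in J -> wact x.2 a = e.1 -> 0 <= shift x a.
  move=> aJ h; move: hp; rewrite apos_eacta -h (shiftV _ hx) (asimple_level hJ he) h.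
  by move: (isneg _) => i; lia.
move=> a aJ; have [h|h1] := eqVneq (wact x.2 a) e.1.
  by rewrite h shift_simple1 mulr1 key.
have [h|h2] := eqVneq (wact x.2 a) (oppD e.1).
  rewrite h (shift_opp _ in_Wext_simple) shift_simple1 mulrN1 -(shift_opp _ hx).
  by rewrite key ?oppD_in // (wact_oppD _ (in_W_full hx)) h oppDK.
by rewrite shift_simple0 ?wact_in ?mulr0.
Qed.

Lemma inversions_mul_simple x : in_Wext J x -> apos (eacta x e) ->
  inversions J (emul x (aff_refl e)) = (inversions J x).+2.
Proof.
move=> hx hp; have hs := in_Wext_simple.
rewrite -(inversionsV (in_Wext_mul hx hs)) (einvM hx hs) einv_aff_refl.
by rewrite inversions_simple_mul ?inversionsV ?(einvK hx) //; exact: in_Wext_inv.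
Qed.

Lemma apos_simple_neg x : in_Wext J x ->
  apos (eacta (emul x (aff_refl e)) e) = ~~ apos (eacta x e).
Proof.
move=> hx; rewrite (eactaM _ hx in_Wext_simple) eacta_refl.
have -> : arefl e e = aopp e :> (D * int).
  rewrite /arefl /aopp pairing_root_coroot; congr (_, _); ring.
by rewrite (eacta_opp _ hx) apos_opp.
Qed.

End Simple.

(** Otherwise the inverse of [x] keeps the simple roots positive, hence all positive affine roots of
    [J], and has no inversion. *)
Lemma exists_descent x : in_Wext J x -> inversions J x != 0%N ->
  exists2 e, asimple J e & ~~ apos (eacta (einv x) e).
Proof.
move=> hx; apply: contra_neqP => no; rewrite -(inversionsV hx).
have hi := in_Wext_inv hx.
apply: inversions_eq0 => // a aJ.
have := @simple_apos _ hi _ (a, isneg a) aJ; rewrite apos_eacta subrr; apply.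
  by move=> e he; apply/negPn/negP => h; apply: no; exists e.
by rewrite /apos.
Qed.

End Subsystem.

End AffineAction.

Section Descent.
Variables (n : nat) (D : rootDatum n) (J : {set D}) (hJ : root_subsystem J).
Variables (e : affroot D) (he : asimple J e).
Implicit Types x y : ext n.

Lemma inversions_mul_simpleN x : in_Wext J x -> ~~ apos (eacta x e) ->
  inversions J x = (inversions J (emul x (aff_refl e))).+2.
Proof.
move=> hx hn; have hs := in_Wext_simple he.
have := inversions_mul_simple hJ he (in_Wext_mul hx hs).
by rewrite (apos_simple_neg he hx) -emulA aff_reflK emulx1 => /(_ hn).
Qed.

Lemma inversions_simple_mulN x : in_Wext J x -> ~~ apos (eacta (einv x) e) ->
  inversions J x = (inversions J (emul (aff_refl e) x)).+2.
Proof.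
move=> hx hn; have hs := in_Wext_simple he.
rewrite -(inversionsV hJ hx) (inversions_mul_simpleN (in_Wext_inv hx) hn).
by rewrite -{1}(einv_aff_refl e) -(einvM hs hx) (inversionsV hJ (in_Wext_mul hs hx)).
Qed.

Lemma apos_simple_mul x : in_Wext J x ->
  apos (eacta (einv (emul (aff_refl e) x)) e) = ~~ apos (eacta (einv x) e).
Proof.
move=> hx; have hs := in_Wext_simple he.
by rewrite (einvM hs hx) einv_aff_refl (apos_simple_neg he (in_Wext_inv hx)).
Qed.

End Descent.

(** * The length as half the number of inversions *)

Section ExtLength.
Variables (R : rcfType) (n : nat) (D : rootDatum n).
Variables (J : {set D}) (hJ : root_subsystem J).
Implicit Types (e f : affroot D) (s : seq (affroot D)) (x y : ext n) (z : 'cV[R]_n).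

Lemma aff_prod_cons e s : aff_prod (e :: s) = emul (aff_refl e) (aff_prod s).
Proof. by rewrite /aff_prod big_cons. Qed.

Lemma aff_eval_eacta x e z : in_Wext J x -> aff_eval (eacta x e) (eact x z) = aff_eval e z.
Proof.
move=> hx; rewrite /aff_eval /eact /= rmorphB /= pairingDr pairing_map.
rewrite -pairing_mulmx -map_mxM (root_wact _ (in_W_full hx)).
by rewrite -mulmxA (mulVmx (in_W_unit hx)) mulmx1; ring.
Qed.

Lemma eactM x y z : eact (emul x y) z = eact x (eact y z).
Proof. by rewrite /eact /= map_mxD !map_mxM mulmxDr addrA mulmxA. Qed.

Lemma eact1 z : eact (eone n) z = z.
Proof. by rewrite /eact /= map_mx0 map_mx1 mul1mx add0r. Qed.

Lemma eact_alcove x z : in_Wext J x -> inversions J x = 0%N ->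
  alcove J z -> alcove J (eact x z).
Proof.
move=> hx h0 hz e [eJ /aff_posP ep].
rewrite -(eactaVK e hx) aff_eval_eacta //; apply: hz; split.
  by rewrite eacta_in //; exact: in_Wext_inv.
by apply/aff_posP; rewrite (inversions0_apos (J := J)) ?inversionsV.
Qed.

(** For the direct implication, positivity of an affine root is tested on [base_alcove], which is
    contained in the alcove of [J]. *)
Lemma in_OmegaP x : in_Wext J x -> in_Omega R J x <-> inversions J x = 0%N.
Proof.
move=> hx; split=> [[_ hA]|h0]; last first.
  split=> //; apply/seteqP; split=> [_ [z hz <-]|z hz]; first exact: eact_alcove.
  exists (eact (einv x) z).
    by apply: eact_alcove hz; [exact: in_Wext_inv | rewrite inversionsV].
  by rewrite -eactM (emulxV (in_Wext_unit hx)) eact1.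
have hi := in_Wext_inv hx.
rewrite -(inversionsV hJ hx); apply: inversions_eq0 => // a aJ.
suff : apos (eacta (einv x) (a, isneg a)) by rewrite apos_eacta subrr.
apply/(aff_posP R) => z hz.
have hz' : alcove J z by move=> e [_ ep]; exact: ep.
have : alcove J (eact x z) by rewrite -hA; exists z.
move=> h; rewrite -(aff_eval_eacta _ z hx) (eactaVK _ hx); apply: h; split=> //.
by apply/aff_posP; rewrite /apos.
Qed.

Lemma in_Wext_aff_prod s : (forall e, e \in s -> e.1 \in J) -> in_Wext J (aff_prod s).
Proof.
elim: s => [|e s IH] h; first by rewrite /aff_prod big_nil; exact: in_Wext1.
rewrite aff_prod_cons; apply: in_Wext_mul.
  by apply: in_Wext_aff_refl; apply: h; rewrite mem_head.
by apply: IH => f fs; apply: h; rewrite inE fs orbT.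
Qed.

Lemma inversions_aff_prod s : (forall e, e \in s -> asimple J e) ->
  (inversions J (aff_prod s) <= (size s).*2)%N.
Proof.
elim: s => [|e s IH] h.
  rewrite /aff_prod big_nil (inversions_eq0 hJ) //; last exact: in_Wext1.
  by move=> a _; rewrite shift1.
have he : asimple J e by apply: h; rewrite mem_head.
have hs : forall f, f \in s -> asimple J f by move=> f fs; apply: h; rewrite inE fs orbT.
have hp : in_Wext J (aff_prod s) by apply: in_Wext_aff_prod => f /hs [].
rewrite aff_prod_cons (leq_trans (inversionsM_le hJ (in_Wext_simple he) hp)) //.
by rewrite inversions_simple // doubleS !addSn add0n !ltnS; exact: IH.
Qed.

Lemma exists_word x : in_Wext J x -> exists s sigma,
  [/\ (size s).*2 = inversions J x, forall e, e \in s -> asimple J e,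
      in_Omega R J sigma & x = emul (aff_prod s) sigma].
Proof.
have [k] := ubnP (inversions J x); elim: k x => // k IH x hk hx.
have [h0|h0] := eqVneq (inversions J x) 0%N.
  exists [::], x; split=> //; first by apply/in_OmegaP.
  by rewrite /aff_prod big_nil emul1x.
have [e he hn] := exists_descent hJ hx h0.
have hsx := in_Wext_mul (in_Wext_simple he) hx.
have hi := inversions_simple_mulN hJ he hx hn.
have [|s [sigma [h1 h2 h3 h4]]] := IH (emul (aff_refl e) x) _ hsx.
  by move: hk; rewrite hi; lia.
exists (e :: s), sigma; split=> //.
- by rewrite hi -h1.
- by move=> f /[1!inE] /orP [/eqP ->|/h2].
- by rewrite aff_prod_cons -emulA -h4 emulA aff_reflK emul1x.
Qed.

(** Removing descents produces a word of this length, and subadditivity of [inversions] forbids a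
    shorter one. *)
Lemma ext_lengthE x : in_Wext J x -> (ext_length R J x).*2 = inversions J x.
Proof.
move=> hx; have [s [sigma [h1 h2 h3 h4]]] := exists_word hx.
rewrite -h1; congr (_.*2); apply: least_eq.
  by exists s, sigma; split=> // a /h2 /aff_simpleP.
move=> _ [s' [sigma' [<- h2' h3' h4']]].
have hs' a : a \in s' -> asimple J a by move=> /h2' /aff_simpleP.
rewrite -leq_double h1 h4'.
have hp : in_Wext J (aff_prod s') by apply: in_Wext_aff_prod => a /hs' [].
have [hS _] := h3'.
rewrite (leq_trans (inversionsM_le hJ hp hS)) //.
by have /in_OmegaP -> // := h3'; rewrite addn0; exact: inversions_aff_prod.
Qed.

End ExtLength.

(** * Finite Weyl groups *)

Section FiniteWeyl.
Variables (n : nat) (D : rootDatum n).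
Implicit Types (a b c d : D) (u v : 'M[int]_n) (s : seq D).

Definition lin u : ext n := (0, u).

Lemma linM u v : emul (lin u) (lin v) = lin (u *m v).
Proof. by rewrite /emul /= mulmx0 addr0. Qed.

Lemma aff_refl0 a : aff_refl (a, 0) = lin (refl a).
Proof. by rewrite /aff_refl /= scale0r oppr0. Qed.

Lemma einv_lin u : einv (lin u) = lin (invmx u).
Proof. by rewrite /einv /= mulmx0 oppr0. Qed.

Lemma eacta_lin u a : eacta (lin u) (a, 0) = (wact u a, 0) :> (D * int).
Proof. by rewrite /eacta /= pairing0r subr0. Qed.

Lemma arefl0 a b : arefl (a, 0) (b, 0) = (srefl a b, 0) :> (D * int).
Proof. by rewrite /arefl /= mulr0 subr0. Qed.

Lemma apos_lin u a : apos (eacta (lin u) (a, 0)) = (wact u a \in posroots D).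
Proof. by rewrite eacta_lin apos0. Qed.

Lemma shift_lin u a : shift (lin u) a = isneg (wact u a) - isneg a.
Proof. by rewrite /shift pairing0r add0r. Qed.

(** Pairing the relation with [coroot b], the two pairings have product 4. Up to the sign of [a],
    the first is 1, 2 or 4, and reducedness leaves only 2. *)
Lemma root_parallel a b :
  pairing (root b) (coroot a) *: root a = 2 *: root b -> b = a \/ b = oppD a.
Proof.
have scal2 (chi psi : 'rV[int]_n) (k : int) : k != 0 -> k *: chi = k *: psi -> chi = psi.
  move=> k0 h; apply/rowP => i; have /rowP/(_ i) := h.
  by rewrite [LHS]mxE [RHS]mxE => /(mulfI k0).
wlog xp : a / 0 <= pairing (root b) (coroot a).
  move=> wl h; have [xp|xn] := leP 0 (pairing (root b) (coroot a)); first exact: wl.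
  case: (wl (oppD a)) => [||->|->]; rewrite ?oppDK; [|  | by right | by left].
    by rewrite coroot_oppD pairingNr oppr_ge0 ltW.
  by rewrite coroot_oppD root_oppD pairingNr scalerN scaleNr opprK.
move=> h.
have h4 : pairing (root b) (coroot a) * pairing (root a) (coroot b) = 2 * 2.
  by rewrite -pairingZl h pairingZl pairing_root_coroot.
have : [|| pairing (root b) (coroot a) == 1, pairing (root b) (coroot a) == 2
         | pairing (root b) (coroot a) == 4].
  move: h4 xp; move: (pairing _ _) (pairing _ _) => y x; clear => h4 xp.
  have x0 : 0 < x by rewrite lt0r xp andbT; apply: contra_eqN h4 => /eqP ->; rewrite mul0r.
  have y0 : 0 < y by rewrite -(pmulr_rgt0 _ x0) h4.
  have x4 : x <= 4 by nia.
  have : x != 3 by apply: contra_eqN h4 => /eqP ->; lia.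
  by move: x0 x4; clear; lia.
move=> /or3P [] /eqP x; rewrite x in h.
- by case: (@root_reduced _ _ b a); rewrite -h scale1r.
- by left; apply/esym/root_inj/(scal2 _ _ 2).
- case: (@root_reduced _ _ a b); apply: (scal2 _ _ 2) => //.
  by rewrite -h scalerA.
Qed.

Section Subsystem.
Variables (J : {set D}) (hJ : root_subsystem J).

(** These are the simple roots of the finite system: by [decomp_level0], decompositions in level
    zero stay in level zero. *)
Definition simple0 a : Prop := asimple J (a, 0).

Lemma simple0_pos a : simple0 a -> a \in posroots D.
Proof. by case=> _; rewrite apos0. Qed.

Lemma simple0_in a : simple0 a -> a \in J.
Proof. by case. Qed.

Lemma srefl_simple0_pos a b : simple0 a -> b \in J -> b \in posroots D ->
  b != a -> srefl a b \in posroots D.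
Proof.
move=> ha bJ bp ne; have := @arefl_pos _ _ J (a, 0) (b, 0) hJ ha bJ.
rewrite arefl0 !apos0; apply=> //; apply: contra ne => /eqP [->]; exact: eqxx.
Qed.

Lemma decomp0 a : a \in J -> a \in posroots D ->
  exists2 s : seq (affroot D), forall e, e \in s -> simple0 e.1 & is_sum (a, 0) s.
Proof.
move=> aJ; rewrite -apos0 => ap; have [s hs es] := @pos_decomp _ _ J (a, 0) aJ ap.
exists s => // e he; have := hs e he.
have := decomp_level0 es (fun e es => let: And3 _ p _ := hs e es in p) he.
by rewrite /simple0; case: e {he} => b k /= ->.
Qed.

(** A positive root [a] that is not simple pairs positively with some simple [b]; then [s_b a] is a
    positive root of smaller [ht], and [s_a] is the conjugate of its reflection by [s_b]. *)
Lemma simple_words u : in_W_ J u ->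
  exists2 s : seq D, forall a, a \in s -> simple0 a & u = refl_prod s.
Proof.
have gen a : a \in J ->
    exists2 s : seq D, forall a, a \in s -> simple0 a & refl a = refl_prod s.
  wlog ap : a / a \in posroots D.
    move=> wl aJ; have [ap|an] := boolP (a \in posroots D); first exact: wl.
    by rewrite -refl_oppD; apply: wl; rewrite ?posroots_oppD ?oppD_in.
  have [k] := ubnP `|ht a|%N; elim: k a ap => // k IH a ap hk aJ.
  have [sa|nsa] := pselect (simple0 a).
    by exists [:: a]; rewrite ?refl_prod1 // => b /[1!inE] /eqP ->.
  have [t tS [e1 _]] := decomp0 aJ ap.
  have [b sb hb] : exists2 b, simple0 b & 0 < pairing (root a) (coroot b).
    apply: contrapT => no; have := pairing_root_coroot a.
    rewrite {1}[root a]e1 pairing_suml => h.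
    suff : \sum_(f <- t) pairing (root f.1) (coroot a) <= 0 by rewrite h.
    rewrite big_seq; apply: sumr_le0 => f ft; rewrite leNgt; apply/negP.
    by move=> /pairing_gt0C hf; apply: no; exists f.1; first exact: tS.
  have ba : a != b by apply: contraPneq sb => <-.
  have cp := srefl_simple0_pos sb aJ ap ba.
  have bp := simple0_pos sb.
  have [||s hs es] := IH (srefl b a) cp; last 1 first.
  - have e : refl a = refl b *m refl (srefl b a) *m refl b.
      by rewrite -refl_srefl sreflK.
    exists (b :: s ++ [:: b]); last first.
      by rewrite refl_prod_cons refl_prod_cat refl_prod1 -es e mulmxA.
    by move=> c; rewrite inE mem_cat inE => /orP [/eqP ->|/orP [/hs|/eqP ->]].
  - move: cp bp ap hk; rewrite !posroots_ht /ht root_srefl mul_refl pairingDl.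
    rewrite pairingNl pairingZl; move: hb.
    move: (pairing (root a) (coroot b)) (pairing (root a) _) (pairing (root b) _).
    move=> x y z; nia.
  - by rewrite srefl_in // simple0_in.
elim/in_W_ind => [|a v aJ _ [s2 h2 ->]].
  by exists [::]; rewrite // /refl_prod big_nil.
have [s1 h1 ->] := gen a aJ; exists (s1 ++ s2); last by rewrite refl_prod_cat.
by move=> b; rewrite mem_cat => /orP [/h1|/h2].
Qed.

Lemma in_W_word s : (forall a, a \in s -> simple0 a) -> in_W_ J (refl_prod s).
Proof. by move=> h; exists s => // a /h /simple0_in. Qed.

(** Follow [a] through the word from right to left. The letter [b] that turns it negative is its
    image under the suffix, so the suffix conjugates [s_a] to [s_b] and this letter cancels. *)
Lemma exchange s a : (forall b, b \in s -> simple0 b) -> simple0 a ->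
  wact (refl_prod s) a \notin posroots D ->
  exists t : seq D, [/\ forall b, b \in t -> simple0 b, (size t).+1 = size s &
    refl_prod s *m refl a = refl_prod t].
Proof.
move=> + ha; elim: s => [_|b s IH hbs].
  by rewrite /refl_prod big_nil wact1 (simple0_pos ha).
have hb : simple0 b by apply: hbs; rewrite mem_head.
have hs c : c \in s -> simple0 c by move=> cs; apply: hbs; rewrite inE cs orbT.
have hW := in_W_word hs.
rewrite refl_prod_cons (wactM _ (in_WT_refl b) (in_W_full hW)) wact_refl.
have [vp|vn] := boolP (wact (refl_prod s) a \in posroots D); last first.
  move=> _; have [t [h1 h2 h3]] := IH hs vn.
  exists (b :: t); split; last by rewrite refl_prod_cons -mulmxA h3.
    by move=> c /[1!inE] /orP [/eqP ->|/h1].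
  by rewrite /= h2.
have [e _|ne] := eqVneq (wact (refl_prod s) a) b.
  exists s; split=> //.
  rewrite -e (refl_wact _ (in_W_full hW)) (mulmxKV (in_W_unit hW)).
  by rewrite -mulmxA reflK mulmx1.
by rewrite srefl_simple0_pos // wact_in // simple0_in.
Qed.

(** If a word for [u] ends in [a], the prefix makes [a] negative, and [exchange] gives a word
    shorter by two letters. *)
Lemma pos_preserving_eq1 u : in_W_ J u ->
  (forall a, a \in J -> a \in posroots D -> wact u a \in posroots D) -> u = 1%:M.
Proof.
move=> /simple_words [s hs ->] hp; have [k] := ubnP (size s).
elim: k s hs hp => // k IH s; case/lastP: s => [|s a] hs hp hk.
  by rewrite /refl_prod big_nil.
have ha : simple0 a by apply: hs; rewrite mem_rcons mem_head.
have hs' b : b \in s -> simple0 b by move=> bs; apply: hs; rewrite mem_rcons inE bs orbT.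
have hW := in_W_full (in_W_word hs').
have e : refl_prod (rcons s a) = refl_prod s *m refl a.
  by rewrite -cats1 refl_prod_cat refl_prod1.
have hn : wact (refl_prod s) a \notin posroots D.
  have := hp a (simple0_in ha) (simple0_pos ha).
  rewrite e (wactM _ hW (in_WT_refl a)) wact_refl -/(oppD a) (wact_oppD _ hW).
  by rewrite posroots_oppD.
have [t [h1 h2 h3]] := exchange hs' ha hn.
rewrite e h3 in hp *; apply: IH => //.
by move: hk; rewrite size_rcons -h2; lia.
Qed.

Lemma exists_descent0 x : in_Wext J x ->
  (exists2 a, a \in J & a \in posroots D /\ ~~ apos (eacta x (a, 0))) ->
  exists2 a, simple0 a & ~~ apos (eacta x (a, 0)).
Proof.
move=> hx [a aJ [ap an]]; apply: contrapT => no; move/negP: an; apply.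
apply: (simple_apos0 hx) => // b sb; apply/negPn/negP => hb; apply: no.
by exists b.
Qed.

(** Induction on inversions. Some simple [b] of [J] is made negative by [s_a]; either [s_a b = - b]
    and the roots are proportional, or conjugating by [s_b] shortens [s_a] on both sides. *)
Lemma refl_in_W a : in_W_ J (refl a) -> a \in J.
Proof.
have [k] := ubnP (inversions J (lin (refl a))); elim: k a => // k IH a hk hW.
have hx : in_Wext J (lin (refl a)) by [].
have [|b sb hb] := exists_descent0 hx.
  apply: contrapT => no; have : refl a = 1%:M.
    apply: pos_preserving_eq1 => // b bJ bp; rewrite -apos_lin; apply/negPn/negP => hb.
    by apply: no; exists b.
  move=> e; have h := root_mul_refl a; rewrite e mulmx1 in h.
  by have := pairing_root_coroot a; rewrite h pairingNl pairing_root_coroot.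
have bJ := simple0_in sb.
rewrite apos_lin wact_refl in hb.
have rW : in_W_ J (refl b) := in_W_refl bJ.
have oJ : oppD (srefl a b) \in J by rewrite oppD_in // -wact_refl wact_in.
have [e|ne] := eqVneq (oppD (srefl a b)) b.
  have h2 : pairing (root b) (coroot a) *: root a = 2 *: root b.
    have : root (srefl a b) = - root b by rewrite -{2}e root_oppD opprK.
    rewrite root_srefl mul_refl => /(congr1 (fun r => root b - r)).
    by rewrite opprB opprK addrCA subrr addr0 => ->; rewrite scaler_nat mulr2n.
  by move: bJ; case: (root_parallel h2) => ->; rewrite ?oppD_in.
have hs : aff_refl (b, 0) = lin (refl b) := aff_refl0 b.
have hbx : ~~ apos (eacta (lin (refl a)) (b, 0)) by rewrite apos_lin wact_refl.
have hy : in_Wext J (emul (lin (refl a)) (aff_refl (b, 0))).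
  by apply: in_Wext_mul => //; rewrite hs.
have i1 := inversions_mul_simpleN hJ sb hx hbx.
have e1 : einv (emul (lin (refl a)) (aff_refl (b, 0))) = emul (lin (refl b)) (lin (refl a)).
  by rewrite (einvM hx (in_Wext_simple sb)) einv_aff_refl hs einv_lin invmx_refl.
have i2 := inversions_simple_mulN hJ sb hy.
have fin : emul (aff_refl (b, 0)) (emul (lin (refl a)) (aff_refl (b, 0))) = lin (refl (srefl b a)).
  by rewrite hs !linM refl_srefl mulmxA.
have aW := in_WT_refl a; have bW := in_WT_refl b.
suff : srefl b a \in J by rewrite srefl_in.
apply: IH; last by rewrite refl_srefl; exact: in_W_mul (in_W_mul rW hW) rW.
rewrite -fin; move: i2; rewrite e1 linM apos_lin (wactM _ bW aW) !wact_refl.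
have np : srefl b (oppD (srefl a b)) \in posroots D.
  by apply: srefl_simple0_pos => //; rewrite posroots_oppD.
have -> : srefl b (srefl a b) \notin posroots D.
  by rewrite -posroots_oppD -[oppD _]/(oppD _) -(wact_refl b) -(wact_oppD _ bW) wact_refl.
move=> /(_ isT) i2; move: hk; rewrite i1 i2; lia.
Qed.

End Subsystem.

End FiniteWeyl.

(** * Length and Bruhat edges in the finite Weyl group *)

Section WeylLength.
Variables (n : nat) (D : rootDatum n).
Implicit Types (a b c : D) (u v : 'M[int]_n).

Local Notation setT := [set: D].
Let hT := root_subsystemT D.

Lemma in_DT a : a \in setT. Proof. by rewrite finset.in_setT. Qed.

(** [simple_root] excludes only sums of two roots. In a longer sum some term pairs positively with
    [a]; subtracting it from [a] leaves a positive root. *)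
Lemma simple0P a : simple0 setT a <-> simple_root a.
Proof.
split=> [[_ ap h]|/andP [ap /existsPn h]].
  rewrite apos0 in ap; rewrite /simple_root ap /=; apply/existsPn => b.
  apply/negP => /andP [bp /existsP [c /andP [cp /eqP e]]].
  apply: (h [:: (b, 0); (c, 0)]) => //; last first.
    by split; rewrite !big_cons big_nil /= addr0.
  by move=> f; rewrite !inE => /orP [] /eqP ->; rewrite /= apos0.
split; rewrite ?in_DT ?apos0 // => s hs hp es.
have h0 := decomp_level0 es (fun e es => (hp e es).2).
have pos e : e \in s -> 0 < ht e.1.
  move=> he; have [_] := hp e he; rewrite -posroots_ht -apos0 -(h0 _ he).
  by case: (e).
have [e1 _] := es.
have [e he hpair] : exists2 e, e \in s & 0 < pairing (root a) (coroot e.1).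
  apply: contrapT => no; have := pairing_root_coroot a.
  rewrite {1}[root a]e1 pairing_suml => h2.
  suff : \sum_(f <- s) pairing (root f.1) (coroot a) <= 0 by rewrite h2.
  rewrite big_seq; apply: sumr_le0 => f fs; rewrite leNgt; apply/negP.
  by move=> /pairing_gt0C hf; apply: no; exists f.
have rest : 0 < \sum_(f <- rem e s) ht f.1.
  have hr g : g \in rem e s -> 0 < ht g.1 by move=> /mem_rem /pos.
  have : (0 < size (rem e s))%N by rewrite size_rem // -subn1 subn_gt0.
  case: (rem e s) hr => // g t hr _; rewrite big_cons ltr_wpDr //.
    by rewrite big_seq; apply: sumr_ge0 => i it; rewrite ltW // hr // inE it orbT.
  by rewrite hr // mem_head.
have eht : ht a = ht e.1 + \sum_(f <- rem e s) ht f.1.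
  by rewrite {1}/ht e1 (big_rem e) //= pairingDl pairing_suml.
have ne : a != e.1.
  by apply: contraTneq rest => h1; move: eht; rewrite -h1; move: (\sum_(_ <- _) _) => x; lia.
have [c hc] : exists c, root c = root a - root e.1.
  by case: (root_sub hpair ne) => hc; eexists; exact: hc.
have cp : c \in posroots D.
  by rewrite posroots_ht /ht hc pairingDl pairingNl -/(ht a) -/(ht _) eht addrC addKr.
have := h e.1; rewrite posroots_ht pos //= => /existsPn /(_ c).
by rewrite cp hc addrC subrK eqxx.
Qed.

Lemma inversions1 (J : {set D}) : inversions J (lin 1%:M) = 0%N.
Proof. by apply: big1 => a _; rewrite shift_lin wact1 subrr. Qed.

Lemma WlengthE u : in_W D u -> (Wlength D u).*2 = inversions setT (lin u).
Proof.
move=> hu.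
have [s [h1 h2 h3]] : exists s : seq D,
    [/\ (size s).*2 = inversions setT (lin u), all (@simple_root n D) s & u = refl_prod s].
  have [k] := ubnP (inversions setT (lin u)); elim: k u hu => // k IH u hu hk.
  have hx : in_Wext setT (lin u) by [].
  have [[a ap an]|no] :=
      pselect (exists2 a, a \in posroots D & wact (invmx u) a \notin posroots D).
    have [|b sb hb] := exists_descent0 (x := einv (lin u)) (in_Wext_inv hx).
      by exists a; rewrite ?in_DT // einv_lin apos_lin.
    have hi := inversions_simple_mulN hT sb hx hb.
    rewrite aff_refl0 linM in hi.
    have [||s [h1 h2 h3]] := IH (refl b *m u).
    - by apply: in_W_mul => //; exact: in_WT_refl.
    - by move: hk; rewrite hi; lia.
    exists (b :: s); split; rewrite /= ?doubleS ?h1 //.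
      by rewrite h2 andbT; apply/simple0P.
    by rewrite refl_prod_cons -h3 mulmxA reflK mul1mx.
  exists [::].
  have u1 : invmx u = 1%:M.
    apply: (pos_preserving_eq1 hT (in_W_inv hu)) => a _ ap.
    by apply/negPn/negP => an; apply: no; exists a.
  have -> : u = 1%:M by rewrite -[u]invmxK u1 invmx1.
  by split=> //; [rewrite inversions1 | rewrite /refl_prod big_nil].
rewrite -h1; congr (_.*2); apply: least_eq; first by exists s.
move=> _ [t [<- /allP t2 t3]]; rewrite -leq_double h1 t3.
elim: t t2 {t3} => [|a t IH] ht; first by rewrite /refl_prod big_nil inversions1.
have sa : simple0 setT a by apply/simple0P/ht; rewrite mem_head.
have ht' : {in t, forall b, simple_root b} by move=> b bt; apply: ht; rewrite inE bt orbT.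
rewrite refl_prod_cons -linM -aff_refl0.
have hW : in_Wext setT (lin (refl_prod t)) by exists t => // b; rewrite in_DT.
rewrite (leq_trans (inversionsM_le hT (in_Wext_simple sa) hW)) //.
by rewrite (inversions_simple hT sa) /= doubleS add2n !ltnS IH.
Qed.

Definition neg_set u : {set D} := [set b in posroots D | wact u b \notin posroots D].

Lemma inversions_neg_set u : in_W D u -> inversions setT (lin u) = (#|neg_set u|).*2.
Proof.
move=> hu; rewrite /inversions (bigID (fun a => a \in posroots D)) /= -addnn.
have half : (\sum_(a in setT | a \in posroots D) `|shift (lin u) a|)%N = #|neg_set u|.
  rewrite -sum1_card big_mkcond [RHS]big_mkcond /=; apply: eq_bigr => a _.
  rewrite in_DT inE shift_lin /isneg; case: (a \in _) => //=.
  by case: (_ \in _).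
congr (_ + _)%N; first exact: half.
rewrite -half (reindex_inj (inv_inj (@oppDK _ D))) /=; apply: eq_big => a.
  by rewrite !in_DT posroots_oppD negbK.
by rewrite (shift_opp (J := setT)) ?abszN.
Qed.

(** The map sending [b] to [s_a b] if this is positive, and to [b] otherwise, embeds the inversions
    of [u] into those of [u s_a] other than [a]. *)
Lemma neg_set_refl u a : in_W D u -> a \in posroots D -> wact u a \in posroots D ->
  (#|neg_set u| < #|neg_set (u *m refl a)|)%N.
Proof.
move=> hu ap uap.
pose f b := if srefl a b \in posroots D then srefl a b else b.
have act b : wact (u *m refl a) b = wact u (srefl a b).
  by rewrite (wactM _ hu (in_WT_refl a)) wact_refl.
have fi : {in neg_set u &, injective f}.
  move=> b c; rewrite !inE /f => /andP [bp _] /andP [cp _].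
  case: ifP => hb; case: ifP => hc // e.
  - by rewrite -(sreflK a b) e sreflK.
  - by move: hc; rewrite -e sreflK bp.
  - by move: hb; rewrite e sreflK cp.
have fs : [set f b | b in neg_set u] \subset neg_set (u *m refl a) :\ a.
  apply/fintype.subsetP => _ /imsetP [b + ->]; rewrite !inE /f => /andP [bp bn].
  case: ifP => hb; rewrite act.
    rewrite hb sreflK bn /= andbT; apply: contraTneq bp => /(congr1 (srefl a)).
    by rewrite sreflK => ->; rewrite -/(oppD a) posroots_oppD ap.
  rewrite bp /=; apply/andP; split; first by apply: contraNneq bn => ->.
  (* Here [s_a b] is negative, so [b] pairs positively with the coroot of [a], and [u s_a b] is a
     negative root minus a positive multiple of a positive one. *)
  have e1 : ht (srefl a b) = ht b - pairing (root b) (coroot a) * ht a.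
    by rewrite /ht root_srefl mul_refl pairingDl pairingNl pairingZl.
  have e2 : ht (wact u (srefl a b)) =
      ht (wact u b) - pairing (root b) (coroot a) * ht (wact u a).
    rewrite /ht (root_wact _ hu) root_srefl mul_refl mulmxDl mulNmx -scalemxAl.
    by rewrite pairingDl pairingNl pairingZl -!(root_wact _ hu).
  move: hb; rewrite (posroots_ht (srefl _ _)) (posroots_ht (wact _ (srefl _ _))) e1 e2.
  rewrite (posroots_ht b) in bp; rewrite (posroots_ht a) in ap.
  rewrite (posroots_ht (wact u b)) in bn; rewrite (posroots_ht (wact u a)) in uap.
  move: bp ap bn uap; clear; move: (pairing _ _) (ht b) (ht a) (ht _) (ht _).
  by move=> x y z p q h1 h2 h3 h4 /negbT; nia.
have := subset_leq_card fs; rewrite card_in_imset // => /leq_ltn_trans; apply.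
rewrite [X in (_ < X)%N](cardsD1 a) inE ap act -/(oppD a) (wact_oppD _ hu).
by rewrite posroots_oppD uap.
Qed.

Lemma Wlength_refl u a : in_W D u -> a \in posroots D ->
  (Wlength D u < Wlength D (u *m refl a))%N = (wact u a \in posroots D).
Proof.
move=> hu ap; have hu' := in_W_mul hu (in_WT_refl a).
rewrite -ltn_double (WlengthE hu) (WlengthE hu') !inversions_neg_set // ltn_double.
have [h|h] := boolP (wact u a \in _); first exact: neg_set_refl.
apply/negbTE; rewrite -leqNgt ltnW //.
rewrite -{2}[u]mulmx1 -(reflK a) mulmxA; apply: neg_set_refl => //.
by rewrite (wactM _ hu (in_WT_refl a)) wact_refl -/(oppD a) (wact_oppD _ hu) posroots_oppD.
Qed.

(** Otherwise a simple root [b] of [J] becomes negative, and right multiplication by [s_b] gives a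
    shorter element of the same coset. *)
Lemma min_rep_apos (R : rcfType) (J : {set D}) lambda w : root_subsystem J -> in_W_ J w ->
  (forall w', in_W_ J w' ->
    (ext_length R J (lambda, w) <= ext_length R J (lambda, w'))%N) ->
  forall a, a \in J -> a \in posroots D -> apos (eacta (lambda, w) (a, 0)).
Proof.
move=> hJ hw hmin a aJ ap; apply/negPn/negP => an.
have hx : in_Wext J (lambda, w) by [].
have [|b sb hb] := exists_descent0 hx; first by exists a.
have := hmin (w *m refl b) (in_W_mul hw (in_W_refl (simple0_in sb))).
have hx' : in_Wext J (emul (lambda, w) (aff_refl (b, 0))).
  exact: in_Wext_mul hx (in_Wext_simple sb).
have e : emul (lambda, w) (aff_refl (b, 0)) = (lambda, w *m refl b).
  by rewrite aff_refl0 /emul /= mulmx0 addr0.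
rewrite e in hx'.
rewrite -leq_double (ext_lengthE R hJ hx) (ext_lengthE R hJ hx').
by rewrite (inversions_mul_simpleN hJ sb hx hb) e; lia.
Qed.

End WeylLength.

(** * The twisted affine Hecke algebra *)

Section LengthAdditivity.
Variables (n : nat) (D : rootDatum n) (J : {set D}) (hJ : root_subsystem J).
Implicit Types (x y : ext n) (u : 'M[int]_n).

Lemma inversions1x : inversions J (eone n) = 0%N.
Proof. exact: inversions1. Qed.

Lemma inversionsM0 x y : in_Wext J x -> in_Wext J y -> inversions J y = 0%N ->
  inversions J (emul x y) = (inversions J x + inversions J y)%N.
Proof.
move=> hx hy /eqP; rewrite sum_nat_eq0 => /forall_inP h; apply: inversionsM => // a aJ.
by have := h a aJ; rewrite absz_eq0 => /eqP ->; rewrite mul0r.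
Qed.

(** A simple affine root with negative gradient has level 1, and linear elements preserve levels, so
    they cannot make it negative. *)
Lemma lin_descent u : in_W_ J u -> inversions J (lin u) != 0%N ->
  exists2 b, simple0 J b & ~~ apos (eacta (einv (lin u)) (b, 0)).
Proof.
move=> hu h; have [[a k] he hn] := exists_descent hJ (hu : in_Wext J (lin u)) h.
have /= := asimple_level hJ he; rewrite /isneg; case: (boolP (a \in _)) => /= ap k0.
  by rewrite k0 in he hn; exists a.
by move: hn; rewrite einv_lin k0 /apos /eacta /= pairing0r subr0 /isneg; case: (_ \in _).
Qed.

Section MinimalRep.
Variables (m : ext n) (hm : in_Wext J m).
Hypothesis mpos : forall a, a \in J -> a \in posroots D -> apos (eacta m (a, 0)).

Lemma apos_min_lin u b : in_W_ J u -> b \in J ->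
  apos (eacta (emul m (lin u)) (b, 0)) = (wact u b \in posroots D).
Proof.
move=> hu bJ; rewrite (eactaM _ hm (hu : in_Wext J (lin u))) eacta_lin.
have cJ : wact u b \in J by rewrite wact_in.
have [h|h] := boolP (wact u b \in _); first exact: mpos.
rewrite -[wact u b]oppDK; have := mpos (a := oppD (wact u b)).
rewrite oppD_in // posroots_oppD => /(_ cJ h).
have -> : (oppD (oppD (wact u b)), 0) = aopp (oppD (wact u b), 0) :> affroot D.
  by rewrite /aopp oppr0.
by rewrite (eacta_opp _ hm) apos_opp => ->.
Qed.

(** [shift m] is nonpositive on positive roots of [J], while [shift (lin u)] is nonzero only where
    [u] changes signs; checking both directions of change shows that the signs agree. *)
Lemma inversions_min_lin u : in_W_ J u ->
  inversions J (emul m (lin u)) = (inversions J m + inversions J (lin u))%N.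
Proof.
move=> hu; apply: inversionsM => // a aJ.
have cJ : wact u a \in J by rewrite wact_in.
have key c : c \in J -> c \in posroots D -> shift m c <= 0.
  move=> hc cp; have := mpos hc cp.
  by rewrite apos_eacta /= /isneg cp subr0.
rewrite shift_lin; have := key (oppD (wact u a)); have := key _ cJ.
rewrite posroots_oppD oppD_in // cJ (shift_opp _ hm) /isneg.
case: (wact u a \in posroots D) => /=; case: (a \in posroots D) => /=.
- by rewrite mul0r.
- by move=> /(_ isT) h _; rewrite sub0r mulN1r oppr_ge0.
- by move=> _ /(_ isT isT); rewrite oppr_le0 subr0 mul1r.
- by rewrite mul0r.
Qed.

End MinimalRep.

End LengthAdditivity.

(** * The normalized basis, its inverses and supports *)

Section Hecke.
Variables (R : rcfType) (n : nat) (D : rootDatum n) (q r : nat) (q_gt0 : (0 < q)%N).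
Variables (J : {set D}) (hJ : root_subsystem J).
Variables (H : unitAlgType R) (T : ext n -> H) (hT : hecke_algebra q r J T).
Implicit Types (x y z : ext n) (u : 'M[int]_n) (h : H).

Local Notation v := (sqrtqr R q r).
Local Notation Q := (Qr R q r).
Local Notation Tt := (Ttilde q r J T).

Lemma sqrtqr_neq0 : v != 0.
Proof. by rewrite gt_eqF // sqrtr_gt0 exprn_gt0 // ltr0n. Qed.

Lemma sqrtqr_sq : v ^+ 2 = q%:R ^+ r.
Proof. by rewrite sqr_sqrtr // exprn_ge0 // ler0n. Qed.

Lemma Tt_mul x y : in_Wext J x -> in_Wext J y ->
  inversions J (emul x y) = (inversions J x + inversions J y)%N ->
  Tt x * Tt y = Tt (emul x y).
Proof.
move=> hx hy hi; have [_ _ hmul _] := hT.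
have hl : ext_length R J (emul x y) = (ext_length R J x + ext_length R J y)%N.
  apply: double_inj; rewrite doubleD !ext_lengthE //; exact: in_Wext_mul.
rewrite /Ttilde -scalerAl -scalerAr scalerA hmul // hl.
by rewrite exprD invfM.
Qed.

(** Expand the unit of the algebra in the elements [T x] and multiply by [T (eone n)] on the
    left. *)
Lemma Tt1 : Tt (eone n) = 1.
Proof.
have [_ hspan hmul _] := hT; have h1 := @in_Wext1 n D J.
have l0 : ext_length R J (eone n) = 0%N.
  by apply: double_inj; rewrite ext_lengthE // inversions1x.
rewrite /Ttilde l0 expr0 invr1 scale1r.
have [s [c [hs e1]]] := hspan 1.
rewrite -[LHS]mulr1 {1}e1 mulr_sumr e1 big_seq [RHS]big_seq.
by apply: eq_bigr => x /hs hx; rewrite -scalerAr hmul ?emul1x // l0.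
Qed.

Section Simple.
Variables (e : affroot D) (he : asimple J e).
Local Notation s := (aff_refl e).

Let hs : in_Wext J s := in_Wext_simple he.

Lemma Tt_simple_sq : Tt s * Tt s = 1 - Q *: Tt s.
Proof.
have [_ _ _ hquad] := hT.
have l1 : ext_length R J s = 1%N.
  by apply: double_inj; rewrite ext_lengthE // (inversions_simple hJ he).
rewrite /Ttilde l1 expr1 -scalerAl -scalerAr scalerA -[T _ * T _]expr2.
rewrite hquad; last exact/aff_simpleP.
rewrite -sqrtqr_sq scalerDr !scalerA addrC; congr (_ + _).
  by rewrite -expr2 -exprMn mulVf ?sqrtqr_neq0 // expr1n scale1r.
rewrite -scaleNr; congr (_ *: _); rewrite /Qr.
by have v0 := sqrtqr_neq0; field.
Qed.

Lemma Tt_simple_mulV : Tt s * (Tt s + Q%:A) = 1.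
Proof. by rewrite mulrDr Tt_simple_sq -scalerAr mulr1 subrK. Qed.

Lemma Tt_simple_Vmul : (Tt s + Q%:A) * Tt s = 1.
Proof. by rewrite mulrDl Tt_simple_sq -scalerAl mul1r subrK. Qed.

Lemma Tt_simple_unit : Tt s \is a GRing.unit.
Proof.
by apply/unitrP; exists (Tt s + Q%:A); rewrite Tt_simple_mulV Tt_simple_Vmul.
Qed.

Lemma Tt_simple_inv : (Tt s)^-1 = Tt s + Q%:A.
Proof. by rewrite -[LHS]mulr1 -{1}Tt_simple_mulV mulKr // Tt_simple_unit. Qed.

Lemma Tt_simple_mul x : in_Wext J x -> apos (eacta (einv x) e) ->
  Tt s * Tt x = Tt (emul s x).
Proof.
move=> hx hp; apply: Tt_mul => //.
by rewrite (inversions_simple_mul hJ he hx hp) (inversions_simple hJ he).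
Qed.

Lemma Tt_mul_simple x : in_Wext J x -> apos (eacta x e) ->
  Tt x * Tt s = Tt (emul x s).
Proof.
move=> hx hp; apply: Tt_mul => //.
by rewrite (inversions_mul_simple hJ he hx hp) (inversions_simple hJ he) addn2.
Qed.

Lemma TtV_simple_mul x : in_Wext J x -> (Tt s)^-1 * Tt x =
  Tt (emul s x) + (if apos (eacta (einv x) e) then Q *: Tt x else 0).
Proof.
move=> hx; case: ifPn => hp.
  by rewrite Tt_simple_inv mulrDl Tt_simple_mul // -scalerAl mul1r.
have hsx := in_Wext_mul hs hx.
have e1 : Tt x = Tt s * Tt (emul s x).
  by rewrite (Tt_simple_mul hsx) ?(apos_simple_mul he hx) // emulA aff_reflK emul1x.
by rewrite addr0 e1 mulKr // Tt_simple_unit.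
Qed.

Lemma Tt_mul_simpleE x : in_Wext J x -> Tt x * Tt s =
  Tt (emul x s) - (if apos (eacta x e) then 0 else Q *: Tt x).
Proof.
move=> hx; case: ifPn => hp; first by rewrite subr0 Tt_mul_simple.
have hxs := in_Wext_mul hx hs.
have e1 : Tt x = Tt (emul x s) * Tt s.
  by rewrite (Tt_mul_simple hxs) ?(apos_simple_neg he hx) // -emulA aff_reflK emulx1.
by rewrite [in LHS]e1 -mulrA Tt_simple_sq mulrBr mulr1 -scalerAr -e1.
Qed.

End Simple.

Lemma Tt_unit x : in_Wext J x -> Tt x \is a GRing.unit.
Proof.
have [k] := ubnP (inversions J x); elim: k x => // k IH x hk hx.
have [h0|h0] := eqVneq (inversions J x) 0%N.
  have hi := in_Wext_inv hx; have h0' : inversions J (einv x) = 0%N by rewrite inversionsV.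
  apply/unitrP; exists (Tt (einv x)); rewrite !Tt_mul //.
  - by rewrite (emulVx (in_Wext_unit hx)) (emulxV (in_Wext_unit hx)) Tt1.
  - exact: inversionsM0.
  - exact: inversionsM0.
have [e he hn] := exists_descent hJ hx h0.
have hsx := in_Wext_mul (in_Wext_simple he) hx.
have hi := inversions_simple_mulN hJ he hx hn.
have -> : Tt x = Tt (aff_refl e) * Tt (emul (aff_refl e) x).
  rewrite (Tt_simple_mul he hsx) ?(apos_simple_mul he hx) //.
  by rewrite emulA aff_reflK emul1x.
by rewrite unitrMl ?(Tt_simple_unit he) //; apply: IH => //; move: hk; rewrite hi; lia.
Qed.

Definition Tbar x : H := (Tt (einv x))^-1.

Lemma TbarM x y : in_Wext J x -> in_Wext J y ->
  inversions J (emul x y) = (inversions J x + inversions J y)%N ->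
  Tbar (emul x y) = Tbar x * Tbar y.
Proof.
move=> hx hy hi; have hix := in_Wext_inv hx; have hiy := in_Wext_inv hy.
rewrite /Tbar (einvM hx hy) -Tt_mul ?invrM ?Tt_unit //.
by rewrite -(einvM hx hy) !inversionsV // ?hi 1?addnC //; exact: in_Wext_mul.
Qed.

Lemma Tbar0 x : in_Wext J x -> inversions J x = 0%N -> Tbar x = Tt x.
Proof.
move=> hx h0; have hi := in_Wext_inv hx.
rewrite /Tbar -[LHS]mulr1 -Tt1 -(emulVx (in_Wext_unit hx)) -Tt_mul //.
  by rewrite mulKr // Tt_unit.
exact: inversionsM0.
Qed.

Lemma Tbar_simple e x : asimple J e -> in_Wext J x -> ~~ apos (eacta (einv x) e) ->
  Tbar x = (Tt (aff_refl e))^-1 * Tbar (emul (aff_refl e) x).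
Proof.
move=> he hx hn; have hs := in_Wext_simple he; have hsx := in_Wext_mul hs hx.
rewrite -[in LHS](emul1x x) -(aff_reflK e) -emulA TbarM //; last first.
  rewrite (inversions_simple hJ he) emulA aff_reflK emul1x.
  exact: inversions_simple_mulN.
by rewrite {1}/Tbar einv_aff_refl.
Qed.

(** A list with possible repetitions, so that sums are concatenations; coefficients are collected
    only in [Tt_lindep]. *)
Definition spanned (P : ext n -> Prop) h : Prop := exists l : seq (R * ext n),
  (forall p, p \in l -> P p.2) /\ h = \sum_(p <- l) p.1 *: Tt p.2.

Lemma spanned0 P : spanned P 0.
Proof. by exists [::]; rewrite big_nil. Qed.

Lemma spannedT (P : ext n -> Prop) x : P x -> spanned P (Tt x).
Proof.
move=> Px; exists [:: (1, x)]; rewrite big_seq1 scale1r; split=> // p.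
by rewrite inE => /eqP ->.
Qed.

Lemma spannedD P h1 h2 : spanned P h1 -> spanned P h2 -> spanned P (h1 + h2).
Proof.
move=> [l1 [p1 ->]] [l2 [p2 ->]]; exists (l1 ++ l2); rewrite big_cat; split=> // p.
by rewrite mem_cat => /orP [/p1|/p2].
Qed.

Lemma spannedZ P (c : R) h : spanned P h -> spanned P (c *: h).
Proof.
move=> [l [p ->]]; exists [seq (c * t.1, t.2) | t <- l]; split.
  by move=> _ /mapP [t /p ht ->].
by rewrite big_map scaler_sumr; apply: eq_bigr => t _; rewrite scalerA.
Qed.

Lemma spanned_linear P P' (f : H -> H) h : linear f -> spanned P h ->
  (forall x, P x -> spanned P' (f (Tt x))) -> spanned P' (f h).
Proof.
move=> flin [l [+ ->]] hf; elim: l => [|t l IH] hl.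
  have := flin (-1) 0 0; rewrite big_nil scaler0 addr0 scaleN1r addNr => ->.
  exact: spanned0.
rewrite big_cons flin; apply: spannedD.
  by apply/spannedZ/hf/hl; rewrite mem_head.
by apply: IH => p pl; apply: hl; rewrite inE pl orbT.
Qed.

Lemma spanned_sub (P P' : ext n -> Prop) h :
  (forall x, P x -> P' x) -> spanned P h -> spanned P' h.
Proof. by move=> PP' [l [hl ->]]; exists l; split=> // p /hl /PP'. Qed.

(** Remove a left descent [s]: the inverse of [Tt s] raises [inversions] by at most 2, exactly what
    the descent had removed. *)
Lemma Tbar_lower x : in_Wext J x -> exists2 h,
  spanned (fun z => in_Wext J z /\ (inversions J z < inversions J x)%N) h
  & Tbar x = Tt x + h.
Proof.
have [k] := ubnP (inversions J x); elim: k x => // k IH x hk hx.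
have [h0|h0] := eqVneq (inversions J x) 0%N.
  by exists 0; [exact: spanned0 | rewrite addr0 Tbar0].
have [e he hn] := exists_descent hJ hx h0.
have hs := in_Wext_simple he; have hsx := in_Wext_mul hs hx.
have hi := inversions_simple_mulN hJ he hx hn.
have [|h hspan eh] := IH (emul (aff_refl e) x) _ hsx; first by move: hk; rewrite hi; lia.
exists (Q *: Tt (emul (aff_refl e) x) + (Tt (aff_refl e))^-1 * h).
  apply: spannedD; first by apply/spannedZ/spannedT; split=> //; rewrite hi; lia.
  apply: (spanned_linear _ hspan) => [c y z|z [hz lz]].
    by rewrite mulrDr scalerAr.
  rewrite (TtV_simple_mul he hz).
  apply: spannedD.
    apply: spannedT; split; first exact: in_Wext_mul.
    have := inversionsM_le hJ hs hz; rewrite (inversions_simple hJ he) hi.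
    by move: lz; lia.
  case: ifP => _; last exact: spanned0.
  by apply/spannedZ/spannedT; split=> //; rewrite hi; lia.
rewrite (Tbar_simple he hx hn) eh mulrDr (TtV_simple_mul he hsx) (apos_simple_mul he hx) hn.
by rewrite emulA aff_reflK emul1x addrA.
Qed.

(** Right multiplication by reflections of level zero does not change the translation part, whether
    or not the quadratic relation is used. *)
Lemma Tt_mul_lin u z : in_W_ J u -> in_Wext J z ->
  spanned (fun y => in_Wext J y /\ y.1 = z.1) (Tt z * Tt (lin u)).
Proof.
have [k] := ubnP (inversions J (lin u)); elim: k u z => // k IH u z hk hu hz.
have hx : in_Wext J (lin u) by [].
have hP w : in_W_ J w -> in_Wext J (emul z (lin w)) /\ (emul z (lin w)).1 = z.1.
  by move=> hw; split; [exact: in_Wext_mul | rewrite /= mulmx0 addr0].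
have [h0|h0] := eqVneq (inversions J (lin u)) 0%N.
  rewrite Tt_mul //; last exact: inversionsM0.
  by apply: spannedT; exact: hP.
have [b sb hn] := lin_descent hJ hu h0.
have rb : in_W_ J (refl b) := in_W_refl (simple0_in sb).
have hi := inversions_simple_mulN hJ sb hx hn.
rewrite aff_refl0 linM in hi.
have hru : in_W_ J (refl b *m u) by exact: in_W_mul.
have -> : Tt (lin u) = Tt (lin (refl b)) * Tt (lin (refl b *m u)).
  rewrite -aff_refl0 Tt_simple_mul //; last first.
    by rewrite -linM -aff_refl0 (apos_simple_mul sb).
  by rewrite aff_refl0 linM mulmxA reflK mul1mx.
rewrite mulrA -{1}aff_refl0 (Tt_mul_simpleE sb hz) aff_refl0 mulrDl.
have lt : (inversions J (lin (refl b *m u)) < k)%N by move: hk; rewrite hi; lia.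
have [hz1 hz2] := hP _ rb.
apply: spannedD.
  by rewrite -hz2; apply: IH.
case: ifP => _; first by rewrite oppr0 mul0r; exact: spanned0.
by rewrite -scaleNr -scalerAl; apply/spannedZ/IH.
Qed.

End Hecke.

(** * Dyer's formula for the finite group W_J *)

Section Twist.
Variables (n : nat) (D : rootDatum n).
Implicit Types (a b c d : D) (l : seq D) (J : {set D}).

(* Positivity of [d] in the positive system obtained from [posroots D] by
   changing the signs of the members of [l]. *)
Definition twisted_pos l d : bool :=
  (d \in posroots D) (+) ((d \in l) || (oppD d \in l)).

(* [l] lists an initial section of a reflection order on the positive roots in
   [J] in decreasing order: every member is simple for the positive system
   twisted by the later members. *)
Fixpoint initial_section J l : Prop :=
  if l is b :: l' then
    [/\ b \in J, b \in posroots D, b \notin l',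
        forall d, d \in J -> d != b -> d != oppD b ->
          twisted_pos l' (srefl b d) = twisted_pos l' d
      & initial_section J l']
  else True.

Lemma initial_section_pos J l b : initial_section J l -> b \in l -> b \in posroots D.
Proof.
elim: l => // c l IH [_ cp _ _ /IH h]; rewrite inE => /orP [/eqP -> //|]; exact: h.
Qed.

Lemma initial_section_in J l b : initial_section J l -> b \in l -> b \in J.
Proof.
elim: l => // c l IH [cJ _ _ _ /IH h]; rewrite inE => /orP [/eqP -> //|]; exact: h.
Qed.

Lemma twisted_pos_pos J l d : initial_section J l -> d \in posroots D ->
  twisted_pos l d = (d \notin l).
Proof.
move=> hl dp; rewrite /twisted_pos dp; case: (d \in l) => //=.
suff /negPf -> : oppD d \notin l by [].
by apply: contraL dp => /(initial_section_pos hl); rewrite posroots_oppD.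
Qed.

Lemma twisted_pos_oppD l d : twisted_pos l (oppD d) = ~~ twisted_pos l d.
Proof. by rewrite /twisted_pos posroots_oppD oppDK orbC addNb. Qed.

Lemma twisted_pos_cons l b d : d != b -> d != oppD b ->
  twisted_pos (b :: l) d = twisted_pos l d.
Proof.
move=> h1 h2; rewrite /twisted_pos !inE (negPf h1).
suff /negPf -> : oppD d != b by [].
by apply: contra h2 => /eqP <-; rewrite oppDK.
Qed.

End Twist.

Section Dyer.
Variables (R : rcfType) (n : nat) (D : rootDatum n) (q r : nat) (q_gt0 : (0 < q)%N).
Variables (J : {set D}) (hJ : root_subsystem J).
Variables (H : unitAlgType R) (T : ext n -> H) (hT : hecke_algebra q r J T).
Implicit Types (x y z : ext n) (u : 'M[int]_n) (h : H) (a b : D) (l p : seq D).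

Local Notation Q := (Qr R q r).
Local Notation Tt := (Ttilde q r J T).

(* The image of [x] under the composition, for [b] in [l], of the intertwining
   operators [x |-> x + Q x s_b]. *)
Fixpoint path_sum l x : H :=
  if l is b :: l' then
    path_sum l' x +
      (if apos (eacta x (b, 0)) then 0
       else Q *: path_sum l' (emul x (aff_refl (b, 0))))
  else Tt x.

Lemma path_sum_lin b l u : in_W_ J u -> path_sum (b :: l) (lin u) = path_sum l (lin u) +
  (if wact u b \in posroots D then 0 else Q *: path_sum l (lin (u *m refl b))).
Proof. by move=> hu; rewrite /= apos_lin aff_refl0 linM. Qed.

(** The twisted regular representation in action: the correction in [Q] occurs when [u^-1 a] is
    positive for the system twisted by [l]. The induction adds one root [b] to the twist. *)
Lemma path_sum_intertwine a l u : simple0 J a -> initial_section J l -> in_W_ J u ->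
  (Tt (lin (refl a)))^-1 * path_sum l (lin u) = path_sum l (lin (refl a *m u)) +
    (if twisted_pos l (wact (invmx u) a) then Q *: path_sum l (lin u) else 0).
Proof.
move=> sa; elim: l u => [|b l IH] u hl hu.
  rewrite [path_sum _ _]/= -aff_refl0 (TtV_simple_mul q_gt0 hJ hT sa) //.
  rewrite aff_refl0 linM /twisted_pos !in_nil addbF einv_lin apos_lin.
  by [].
have [bJ bp bl hb hl'] := hl.
have aJ := simple0_in sa; have ap := simple0_pos sa.
have ra : in_W_ J (refl a) := in_W_refl aJ; have rb : in_W_ J (refl b) := in_W_refl bJ.
have hau : in_W_ J (refl a *m u) by exact: in_W_mul.
have hub : in_W_ J (u *m refl b) by exact: in_W_mul.
rewrite !path_sum_lin // mulrDr (IH _ hl' hu).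
set d := wact (invmx u) a.
have ud : wact u d = a by rewrite wactVK //; exact: in_W_full hu.
have dJ : d \in J by rewrite /d wact_in //; exact: in_W_inv.
have dsb : wact (invmx (u *m refl b)) a = srefl b d.
  rewrite (invmxM (in_W_unit hu) (refl_unit b)) invmx_refl.
  by rewrite (wactM _ (in_W_full rb) (in_W_full (in_W_inv hu))) wact_refl.
have sub c : wact (refl a *m u) c = srefl a (wact u c).
  by rewrite (wactM _ (in_W_full ra) (in_W_full hu)) wact_refl.
have IH2 := IH _ hl' hub; rewrite dsb mulmxA in IH2.
have tb : twisted_pos l b by rewrite (twisted_pos_pos hl' bp).
(* If [u^-1 a = b], then [s_a u = u s_b]. Twisting by [b] removes the correction at [u], which
   reappears as the second term of [path_sum] at [s_a u]. *)
have [db|db] := eqVneq d b.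
  have e : refl a *m u = u *m refl b.
    by rewrite -db /d (refl_wact _ (in_W_full (in_W_inv hu))) invmxK mulmxA
       (mulmxA u) mulmxV ?mul1mx // (in_W_unit hu).
  rewrite db tb -db sub ud db -/(oppD a) ap posroots_oppD ap /= mulr0 addr0.
  rewrite (twisted_pos_pos hl bp) mem_head /= addr0 e; congr (_ + _ *: path_sum _ _).
  by rewrite -mulmxA reflK mulmx1.
(* Now twisting by [b] creates a correction at [u], supplied by the induction hypothesis at
   [u s_b]. *)
have [db'|db'] := eqVneq d (oppD b).
  have ub : wact u b = oppD a.
    by rewrite -ud db' -(wact_oppD _ (in_W_full hu)) oppDK.
  have e : refl a *m u = u *m refl b.
    by rewrite -(oppDK b) refl_oppD -db' /d (refl_wact _ (in_W_full (in_W_inv hu))) invmxK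
       mulmxA (mulmxA u) mulmxV ?mul1mx // (in_W_unit hu).
  rewrite sub ub -/(oppD a) -(wact_refl a) (wact_oppD _ (in_W_full ra)) wact_refl.
  rewrite -/(oppD a) oppDK.
  rewrite posroots_oppD ap /= db' !twisted_pos_oppD tb (twisted_pos_pos hl bp) mem_head /=.
  rewrite !addr0 e; congr (_ + _).
  rewrite -scalerAr IH2 db' -(wact_refl b) (wact_oppD _ (in_W_full rb)) wact_refl.
  rewrite -/(oppD b) oppDK tb.
  by rewrite e -mulmxA reflK mulmx1.
(* Elsewhere [s_b] preserves twisted positivity, so [u] and [u s_b] have the same kind of
   correction; as [a] is simple, [s_a] keeps the sign of [u b] and both sides branch alike. *)
have hbs : twisted_pos l (srefl b d) = twisted_pos l d by exact: hb.
rewrite (twisted_pos_cons _ db db').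
have ne : (wact u b != a) && (wact u b != oppD a).
  rewrite -ud -(wact_oppD _ (in_W_full hu)) !(inj_eq (wact_inj (in_W_full hu))) eq_sym db /=.
  by apply: contra db' => /eqP ->; rewrite oppDK.
have -> : (wact (refl a *m u) b \in posroots D) = (wact u b \in posroots D).
  rewrite sub; case/andP: ne => ne1 ne2; have cJ : wact u b \in J by rewrite wact_in.
  have [cp|cn] := boolP (wact u b \in _); first exact: (srefl_simple0_pos hJ sa cJ cp ne1).
  have h1 : oppD (wact u b) \in J by rewrite (oppD_in hJ).
  have h2 : oppD (wact u b) \in posroots D by rewrite posroots_oppD.
  have h3 : oppD (wact u b) != a by apply: contraNneq ne2 => <-; rewrite oppDK.
  have := srefl_simple0_pos hJ sa h1 h2 h3.
  rewrite -(wact_refl a) (wact_oppD _ (in_W_full ra)) posroots_oppD wact_refl.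
  exact: negbTE.
case: (wact u b \in _); first by rewrite mulr0 !addr0.
rewrite -scalerAr IH2 hbs; case: (twisted_pos l d); rewrite ?addr0 ?scalerDr //.
by rewrite addrACA.
Qed.

(** Once [l] contains all positive roots of [J], twisted positivity is reversed. The correction
    vanishes when a descent is restored, which is the recursion satisfied by [Tbar]. *)
Lemma Tbar_path_sum l u : initial_section J l ->
  (forall a, a \in J -> a \in posroots D -> a \in l) -> in_W_ J u ->
  Tbar q r J T (lin u) = path_sum l (lin u).
Proof.
move=> hl full; have [k] := ubnP (inversions J (lin u)); elim: k u => // k IH u hk hu.
have hx : in_Wext J (lin u) by [].
have [h0|h0] := eqVneq (inversions J (lin u)) 0%N.
  rewrite (Tbar0 q_gt0 hJ hT hx h0); elim: l hl {full IH} => // b l IH [bJ bp _ _ /IH hl].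
  rewrite path_sum_lin // -hl -apos_lin (inversions0_apos h0) // apos0 bp addr0.
  by [].
have [b sb hn] := lin_descent hJ hu h0.
have hi := inversions_simple_mulN hJ sb hx hn.
have rb : in_W_ J (refl b) := in_W_refl (simple0_in sb).
have hbu : in_W_ J (refl b *m u) by exact: in_W_mul.
rewrite (Tbar_simple q_gt0 hJ hT sb hx hn) aff_refl0 linM in hi *.
rewrite IH //; last by move: hk; rewrite hi; lia.
rewrite (path_sum_intertwine sb hl hbu) mulmxA reflK mul1mx.
have dJ : wact (invmx (refl b *m u)) b \in J.
  by rewrite wact_in ?(simple0_in sb) //; exact: in_W_inv.
have dp : wact (invmx (refl b *m u)) b \in posroots D.
  have := apos_simple_mul sb hx; rewrite hn aff_refl0 linM einv_lin apos_lin => ->.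
  by [].
by rewrite (twisted_pos_pos hl dp) full // addr0.
Qed.

(** Since [m] keeps the positive roots of [J] positive, [path_sum] branches identically at [u] and
    [m u], and lengths add. *)
Lemma min_path_sum m l u : in_Wext J m ->
  (forall a, a \in J -> a \in posroots D -> apos (eacta m (a, 0))) ->
  initial_section J l -> in_W_ J u ->
  Tt m * path_sum l (lin u) = path_sum l (emul m (lin u)).
Proof.
move=> hm mpos; elim: l u => [|b l IH] u hl hu.
  by rewrite /= (Tt_mul hJ hT) //; exact: inversions_min_lin.
have [bJ bp _ _ hl'] := hl.
rewrite path_sum_lin // mulrDr IH //= (apos_min_lin hJ hm mpos hu bJ); congr (_ + _).
case: ifP => _; first by rewrite mulr0.
by rewrite -scalerAr IH ?aff_refl0 -?emulA ?linM //; apply: in_W_mul => //; exact: in_W_refl.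
Qed.

Fixpoint path_terms l x : seq (R * ext n) :=
  if l is b :: l' then
    path_terms l' x ++
      (if apos (eacta x (b, 0)) then [::]
       else [seq (Q * t.1, t.2) | t <- path_terms l' (emul x (aff_refl (b, 0)))])
  else [:: (1, x)].

Lemma path_sum_terms l x : path_sum l x = \sum_(t <- path_terms l x) t.1 *: Tt t.2.
Proof.
elim: l x => [|b l IH] x /=; first by rewrite big_seq1 scale1r.
rewrite big_cat IH; congr (_ + _); case: ifP => _; first by rewrite big_nil.
by rewrite big_map IH scaler_sumr; apply: eq_bigr => t _; rewrite scalerA.
Qed.

Lemma path_terms_in l x t : {subset l <= J} -> in_Wext J x -> t \in path_terms l x ->
  in_Wext J t.2.
Proof.
elim: l x t => [|b l IH] x t lJ hx /=; first by rewrite inE => /eqP ->.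
have lJ' : {subset l <= J} by move=> c cl; apply: lJ; rewrite inE cl orbT.
rewrite mem_cat => /orP [|]; first exact: IH.
case: ifP => // _ /mapP [t' ht' ->] /=; apply: IH ht' => //.
by apply: in_Wext_mul => //; apply/in_Wext_aff_refl/lJ; rewrite mem_head.
Qed.

Fixpoint subseqs l : seq (seq D) :=
  if l is b :: l' then subseqs l' ++ [seq b :: p | p <- subseqs l'] else [:: [::]].

Lemma mem_subseqs l p : (p \in subseqs l) = subseq p l.
Proof.
elim: l p => [|b l IH] p; first by rewrite inE; case: p.
rewrite /= mem_cat IH; apply/orP/idP => [[h|/mapP [p' + ->]]|].
- exact: subseq_trans h (subseq_cons _ _).
- by rewrite IH /= eqxx.
case: p => [|c p]; first by left; exact: sub0seq.
rewrite /=; case: eqVneq => [->|_] h; last by left.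
by right; apply/mapP; exists p; rewrite ?IH.
Qed.

Lemma uniq_subseqs l : uniq l -> uniq (subseqs l).
Proof.
elim: l => //= b l IH /andP [bl ul]; rewrite cat_uniq IH //=.
rewrite map_inj_uniq ?IH // ?andbT; last by move=> p p' [].
apply/hasPn => _ /mapP [p _ ->]; rewrite mem_subseqs.
by apply: contra bl => /mem_subseq; apply; rewrite mem_head.
Qed.

(** Paths are read from the top, because [path_sum] expands an element through its descents;
    [down_bruhat] reverses them. *)
Fixpoint down_path x p y : bool :=
  if p is b :: p' then
    ~~ apos (eacta x (b, 0)) && down_path (emul x (aff_refl (b, 0))) p' y
  else x == y.

(** Each root of [l] is either skipped or used as an edge with weight [Q], the same binary choice as
    in [subseqs]. *)
Lemma path_terms_coef l x y : \sum_(t <- path_terms l x | t.2 == y) t.1 =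
  \sum_(p <- subseqs l | down_path x p y) Q ^+ size p.
Proof.
elim: l x => [|b l IH] x /=.
  by rewrite !big_cons !big_nil /= expr0.
rewrite !big_cat IH big_map; congr (_ + _) => /=.
case: ifP => hx /=; first by rewrite big_nil big_pred0.
by rewrite big_map /= -mulr_sumr IH mulr_sumr; apply: eq_bigr => p _; rewrite exprS.
Qed.

(** Collecting repeated terms and absorbing the nonzero normalization reduces this to the
    independence of the [T x]. *)
Lemma Tt_lindep (l : seq (R * ext n)) : (forall t, t \in l -> in_Wext J t.2) ->
  \sum_(t <- l) t.1 *: Tt t.2 = 0 -> forall y, \sum_(t <- l | t.2 == y) t.1 = 0.
Proof.
move=> hl h0 y; have [hind _ _ _] := hT.
have [yl|yl] := boolP (y \in undup (map snd l)); last first.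
  rewrite big_seq_cond big1 // => t /andP [tl /eqP ty]; case/negP: yl.
  by rewrite mem_undup -ty; apply: map_f.
pose c x : R := (\sum_(t <- l | t.2 == x) t.1) * sqrtqr R q r ^- ext_length R J x.
suff h : c y = 0.
  move/eqP: h; rewrite mulf_eq0 invr_eq0 expf_eq0 (negPf (sqrtqr_neq0 R r q_gt0)) andbF orbF.
  by move/eqP.
apply: (hind (undup (map snd l)) c) yl; first exact: undup_uniq.
  by move=> x; rewrite mem_undup => /mapP [t /hl + ->].
apply: etrans h0.
transitivity (\sum_(x <- undup (map snd l)) \sum_(t <- l | t.2 == x) t.1 *: Tt t.2).
  apply: eq_bigr => x _; rewrite /c -scalerA -/(Ttilde q r J T x) scaler_suml.
  by apply: eq_bigr => t /eqP ->.
rewrite (exchange_big_dep xpredT) //= big_seq [RHS]big_seq; apply: eq_bigr => t tl.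
rewrite (eq_bigl (pred1 t.2)) => [|x]; last exact: eq_sym.
rewrite -big_filter filter_pred1_uniq ?undup_uniq ?big_seq1 // mem_undup.
exact: map_f.
Qed.

End Dyer.

(** * Reflection orders and root subsystems generated by paths *)

Section JDelta.
Variables (n : nat) (D : rootDatum n).
Implicit Types (J K : {set D}) (p : seq D).

Lemma root_subsystemP J :
  (forall a b, a \in J -> (srefl a b \in J) = (b \in J)) -> root_subsystem J.
Proof.
move=> h; apply/forallP => a; apply/implyP => aJ; apply/forallP => b; apply/eqP.
rewrite -(h a b aJ); apply/idP/existsP => [hb|[c /andP [cJ /eqP e]]].
  by exists (srefl a b); rewrite hb -root_srefl sreflK eqxx.
have -> : b = srefl a c by apply: root_inj; rewrite root_srefl.
by rewrite sreflK.
Qed.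

(** Intersect all root subsystems containing the edges. By [refl_in_W], a reflection lies in [W_L]
    only if its root lies in [L]. *)
Lemma exists_JDelta p : exists K, is_JDelta p K.
Proof.
pose K := [set a | [forall L : {set D}, (root_subsystem L && all (mem L) p) ==> (a \in L)]].
have KP a : reflect (forall L : {set D}, root_subsystem L -> {subset p <= L} -> a \in L)
                    (a \in K).
  rewrite inE; apply: (iffP forallP) => h L.
    by move=> hL /allP pL; have := h L; rewrite hL pL.
  by apply/implyP => /andP [hL /allP pL]; apply: h.
exists K; split; last first.
  move=> L [hL pL]; apply/fintype.subsetP => a /KP; apply=> // b /pL.
  exact: refl_in_W.
split; last by move=> a ap; apply: in_W_refl; apply/KP => L _; apply.
apply: root_subsystemP => a b /KP ha; apply/KP/KP => h L hL pL.
  by rewrite -(srefl_in hL b (ha L hL pL)); exact: h.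
by rewrite (srefl_in hL b (ha L hL pL)); exact: h.
Qed.

Lemma is_JDelta_uniq p J K : is_JDelta p J -> is_JDelta p K -> J = K.
Proof.
move=> [hJ mJ] [hK mK]; apply/eqP; rewrite finset.eqEsubset.
by apply/andP; split; [exact: mJ | exact: mK].
Qed.

Lemma is_JDelta_sub p J K : root_subsystem J -> is_JDelta p K ->
  (K \subset J) = all (mem J) p.
Proof.
move=> hJ [[hK pK] mK]; apply/idP/allP => [/fintype.subsetP KJ a ap|pJ].
  by apply: KJ; apply: refl_in_W hK _ (pK a ap).
by apply: mK; split=> // a /pJ; exact: in_W_refl.
Qed.

(** Since [J_Delta] is unique, the sum has one term or none. *)
Lemma sum_JDelta (R : pzRingType) p J (F : R) : root_subsystem J ->
  \sum_(K : {set D} | (root_subsystem K && (K \subset J)) && `[< is_JDelta p K >]) F =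
  if all (mem J) p then F else 0.
Proof.
move=> hJ; have [K hK] := exists_JDelta p.
rewrite (eq_bigl (fun L => (L == K) && all (mem J) p)); last first.
  move=> L; apply/andP/andP => [[/andP [hL LJ] /asboolP dL]|[/eqP -> h]].
    by rewrite -(is_JDelta_sub hJ dL) LJ; split=> //; apply/eqP/(is_JDelta_uniq dL hK).
  by rewrite (is_JDelta_sub hJ hK) h asboolT //; split=> //; case: hK => -[-> _].
case: ifP => _; last by rewrite big_pred0 // => L; rewrite andbF.
by rewrite (eq_bigl (pred1 K)) ?big_pred1_eq // => L; rewrite andbT.
Qed.

End JDelta.

Section ReflectionOrder.
Variables (R : rcfType) (n : nat) (D : rootDatum n).
Variables (prec : rel (affroot D)) (hprec : reflection_order R prec).
Variables (J : {set D}) (hJ : root_subsystem J).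
Implicit Types (a b c d : D) (l p : seq D).

(** The reverse of [prec], since initial sections are listed in decreasing order. *)
Definition below a b : bool :=
  [&& a \in posroots D, b \in posroots D & prec (b, 0) (a, 0)].

Let aff_pos0 a : a \in posroots D -> aff_pos R ((a, 0) : affroot D).
Proof. by move=> ap; apply/aff_posP; rewrite apos0. Qed.

Lemma below_irr : irreflexive below.
Proof.
move=> a; apply/negP => /and3P [ap _]; case: hprec => h _ _ _.
by apply/negP/h/aff_pos0.
Qed.

Lemma below_trans : transitive below.
Proof.
move=> b a c /and3P [ap bp h1] /and3P [_ cp h2]; rewrite /below ap cp /=.
case: hprec => _ h _ _.
exact: h (aff_pos0 cp) (aff_pos0 bp) (aff_pos0 ap) h2 h1.
Qed.

Lemma below_total a b : a \in posroots D -> b \in posroots D -> a != b ->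
  below a b || below b a.
Proof.
move=> ap bp ne; rewrite /below ap bp /= orbC; case: hprec => _ _ h _.
apply: h; [exact: aff_pos0 | exact: aff_pos0 |].
by apply: contra ne => /eqP [->].
Qed.

Lemma below_between a b c (x y : R) : a \in posroots D -> b \in posroots D ->
  c \in posroots D -> a != b -> 0 < x -> 0 < y ->
  map_mx intr (root c) = x *: map_mx intr (root a) + y *: map_mx intr (root b) ->
  (below c a && below b c) || (below c b && below a c).
Proof.
move=> ap bp cp ne x0 y0 e; rewrite /below ap bp cp /=; case: hprec => _ _ _ h.
apply: (h _ _ _ x y (aff_pos0 ap) (aff_pos0 bp) (aff_pos0 cp)) => //.
  by apply: contra ne => /eqP [->].
by move=> z; rewrite /aff_eval /= e pairingDl !pairingZl !addr0.
Qed.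

(** Here [l] holds the roots of [J] preceding [b]. For positive [d]: if [s_b d] is positive,
    convexity puts it on the same side of [b] as [d]; if it is negative, [b] lies between [d] and
    [- s_b d], exactly one of which is in [l]. *)
Lemma twisted_pos_srefl b l d : b \in J -> b \in posroots D ->
  (forall c, (c \in l) = [&& c \in J, c \in posroots D & below b c]) ->
  d \in J -> d != b -> d != oppD b ->
  twisted_pos l (srefl b d) = twisted_pos l d.
Proof.
move=> bJ bp hl.
have lpos c : c \in l -> c \in posroots D by rewrite hl => /and3P [].
have tw c : c \in posroots D -> twisted_pos l c = (c \notin l).
  move=> cp; rewrite /twisted_pos cp; case: (c \in l) => //=.
  suff /negPf -> : oppD c \notin l by [].
  by apply: contraL cp => /lpos; rewrite posroots_oppD.
have oppb c : srefl b (oppD c) = oppD (srefl b c).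
  by apply: root_inj; rewrite (root_srefl b) (root_oppD c) mulNmx
    (root_oppD (srefl b c)) (root_srefl b).
wlog dp : d / d \in posroots D.
  move=> wl dJ h1 h2; have [dp|dn] := boolP (d \in posroots D); first exact: wl.
  apply: negb_inj; rewrite -!twisted_pos_oppD -oppb; apply: wl.
  - by rewrite posroots_oppD.
  - by rewrite oppD_in.
  - by apply: contra h2 => /eqP <-; rewrite oppDK.
  - by rewrite (inj_eq (inv_inj (@oppDK _ D))).
move=> dJ db dob.
have asym c c' : below c c' -> below c' c -> False.
  by move=> h /(below_trans h); rewrite below_irr.
have mapE c c' (k : int) : root c = root c' + k *: root b ->
    map_mx intr (root c) = 1 *: map_mx intr (root c') + k%:~R *: map_mx intr (root b) :> 'rV[R]_n.
  by move=> ->; rewrite map_mxD map_mxZ scale1r.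
(* A root [c' + k b] with [k > 0] lies between [c'] and [b] in the order, hence on the same side of
   [b] as [c']. *)
have step c c' (k : int) : c \in posroots D -> c' \in posroots D -> c' != b -> 0 < k ->
    root c = root c' + k *: root b -> below b c = below b c'.
  move=> cp cp' ne k0 /mapE e.
  have := below_between cp' bp cp ne (@ltr01 R) _ e; rewrite ltr0z => /(_ k0).
  move=> /orP [] /andP [h1 h2]; first by rewrite h2 (below_trans h2 h1).
  have /negP/negPf -> : ~ below b c by move=> h; exact: asym h1 h.
  by apply/esym/negP => h; apply: (asym _ _ (below_trans h2 h1) h).
have e : root (srefl b d) = root d - pairing (root d) (coroot b) *: root b.
  by rewrite root_srefl mul_refl.
set k := pairing _ _ in e.
have cJ : srefl b d \in J by rewrite (srefl_in hJ).
have cb : srefl b d != b.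
  by apply: contra dob => /eqP h; rewrite -(sreflK b d) h.
have [cp|cn] := boolP (srefl b d \in posroots D).
  rewrite (tw _ cp) (tw _ dp) !hl cJ cp dJ dp /=; congr (~~ _).
  have [k0|k0|k0] := ltgtP k 0.
  - apply: (step _ _ (- k)) => //; first by rewrite oppr_gt0.
    by rewrite e scaleNr.
  - by apply/esym/(step _ _ k) => //; rewrite e subrK.
  - by congr (below _ _); apply: root_inj; rewrite e k0 scale0r subr0.
set c := oppD (srefl b d).
have cp : c \in posroots D by rewrite posroots_oppD.
have ec : root c = k *: root b - root d by rewrite root_oppD e opprB.
have k0 : 0 < k.
  move: cp bp dp; rewrite !posroots_ht /ht ec pairingDl pairingNl pairingZl.
  by move: (pairing _ _) (pairing _ _) => x y; nia.
have dc : d != c.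
  apply/eqP => h; case: (@root_parallel _ _ b d); last 2 first.
  - by move=> h'; rewrite h' eqxx in db.
  - by move=> h'; rewrite h' eqxx in dob.
  by rewrite -/k scaler_nat mulr2n {1}h ec subrK.
(* From [c = k b - d], the root [b] is [d + c] divided by [k]. *)
have kR : 0 < (k%:~R : R)^-1 by rewrite invr_gt0 ltr0z.
have := below_between dp cp bp dc kR kR.
have -> : map_mx intr (root b) = (k%:~R)^-1 *: map_mx intr (root d)
    + (k%:~R)^-1 *: map_mx intr (root c) :> 'rV[R]_n.
  rewrite -scalerDr -map_mxD ec addrCA subrr addr0 map_mxZ scalerA mulVf ?scale1r //.
  by rewrite intr_eq0 gt_eqF.
move=> /(_ erefl) hbet.
rewrite -(oppDK (srefl b d)) -/c twisted_pos_oppD (tw _ cp) (tw _ dp) !hl.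
rewrite (_ : c \in J); last by rewrite oppD_in.
rewrite cp dp dJ /= negbK.
case/orP: hbet => /andP [h1 h2].
  rewrite h1; apply/negbTE/negP => h; exact: asym h h2.
rewrite h1; apply/esym/negP => h; exact: asym h h2.
Qed.

(** As [l] is closed under predecessors, the tail after each [b] consists exactly of the roots of
    [J] preceding [b]. *)
Lemma initial_section_below l : sorted below l ->
  {subset l <= [pred a | (a \in J) && (a \in posroots D)]} ->
  (forall b c, b \in l -> c \in J -> below b c -> c \in l) -> initial_section J l.
Proof.
elim: l => //= b l IH hs hl hi.
have /andP [bJ bp] := hl b (mem_head _ _).
have hl' : {subset l <= [pred a | (a \in J) && (a \in posroots D)]}.
  by move=> c cl; apply: hl; rewrite inE cl orbT.
have /allP bmax := order_path_min below_trans hs.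
have bl : b \notin l by apply/negP => /bmax; rewrite below_irr.
split=> //; last first.
  apply: IH hl' _; first exact: path_sorted hs.
  move=> c d cl dJ h; have := hi c d; rewrite !inE cl orbT => /(_ isT dJ h) /orP [/eqP e|//].
  by have := below_trans (bmax _ cl) h; rewrite e below_irr.
move=> d dJ h1 h2; apply: twisted_pos_srefl => // c.
apply/idP/and3P => [cl|[cJ cp bc]].
  by have /andP [-> ->] := hl' c cl; split=> //; exact: bmax.
have := hi b c (mem_head _ _) cJ bc; rewrite inE => /orP [/eqP e|//].
by move: bc; rewrite e below_irr.
Qed.

Lemma exists_section : exists l, [/\ sorted below l, uniq l &
  l =i [pred a | (a \in J) && (a \in posroots D)]].
Proof.
(* Sorting needs a total relation, hence the reflexive closure; strictness is recovered at the end
   from the absence of repetitions. *)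
pose le a b := (a == b) || below a b.
pose P := [pred a | a \in posroots D].
pose s := enum [pred a | (a \in J) && (a \in posroots D)].
have le_trans : transitive le.
  move=> b a c /orP [/eqP -> //|h1] /orP [/eqP <-|h2]; first by rewrite /le h1 orbT.
  by rewrite /le (below_trans h1 h2) orbT.
have sP : all P s by apply/allP => a; rewrite mem_enum => /andP [].
have tot : {in P &, total le}.
  move=> a b ap bp; rewrite /le eq_sym; case: eqVneq => //= ne.
  by apply: below_total => //; rewrite eq_sym.
have u : uniq (sort le s) by rewrite sort_uniq enum_uniq.
exists (sort le s); split=> //; last by move=> a; rewrite mem_sort mem_enum.
have := sort_sorted_in tot sP; rewrite sorted_pairwise // => h1.
apply: pairwise_sorted; move: u h1; rewrite uniq_pairwise => h2 h1.
have : pairwise [rel x y | (x != y) && le x y] (sort le s) by rewrite pairwise_relI h2.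
by apply: sub_pairwise => a b /= /andP [ne /orP [/eqP e|//]]; rewrite e eqxx in ne.
Qed.

Lemma sorted_subset_subseq l p : sorted below l -> sorted below p -> {subset p <= l} ->
  subseq p l.
Proof.
move=> sl sp pl.
have -> : p = [seq a <- l | a \in p].
  apply: (irr_sorted_eq below_trans below_irr sp); first exact: sorted_filter below_trans _ _ sl.
  by move=> a; rewrite mem_filter; case: (boolP (a \in p)) => // /pl ->.
exact: filter_subseq.
Qed.

Lemma sorted_rev_below p : {subset p <= posroots D} ->
  sorted below (rev p) = sorted (fun a b : D => prec (a, 0) (b, 0)) p.
Proof.
move=> /allP hp; rewrite rev_sorted; apply: (eq_in_sorted _ hp) => a b ap bp.
by rewrite /= /below (ap : a \in posroots D) (bp : b \in posroots D).
Qed.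

End ReflectionOrder.

(** * Translations *)

Section BruhatPaths.
Variables (n : nat) (D : rootDatum n).
Implicit Types (u v : 'M[int]_n) (a b : D) (p : seq D) (lambda : 'cV[int]_n).

Lemma bruhat_path_rcons u p b v : bruhat_path u (rcons p b) v <->
  [/\ bruhat_path u p (v *m refl b), b \in posroots D
    & (Wlength D (v *m refl b) < Wlength D v)%N].
Proof.
elim: p u => [|a p IH] u /=.
  split=> [[bp lt e]|[-> bp lt]].
    by rewrite -e -mulmxA reflK mulmx1.
  by rewrite -mulmxA reflK mulmx1.
split=> [[ap lt /IH [h1 h2 h3]]|[[ap lt h1] h2 h3]] //.
by split=> //; apply/IH.
Qed.

Lemma bruhat_path_pos u p v : bruhat_path u p v -> {subset p <= posroots D}.
Proof.
elim: p u => // a p IH u /= [ap _ /IH h] b; rewrite inE => /orP [/eqP -> //|]; exact: h.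
Qed.

(** Left multiplication by [m] preserves the signs of the roots of level zero, so [m u] descends
    along [b] exactly when [u] does, which [Wlength_refl] translates into lengths. *)
Lemma down_bruhat m p u v : in_Wext [set: D] m ->
  (forall a, a \in posroots D -> apos (eacta m (a, 0))) ->
  in_W D u -> {subset p <= posroots D} ->
  down_path (emul m (lin u)) p (emul m (lin v)) <-> bruhat_path v (rev p) u.
Proof.
move=> hm mpos; elim: p u => [|b p IH] u hu hp.
  rewrite /rev /=; split=> [/eqP e|-> //].
  have := congr1 (emul (einv m)) e.
  by rewrite !emulA (emulVx (in_Wext_unit hm)) !emul1x => -[].
have bp : b \in posroots D by apply: hp; rewrite mem_head.
have hp' : {subset p <= posroots D} by move=> c cp; apply: hp; rewrite inE cp orbT.
have hub : in_W D (u *m refl b) by exact: in_W_mul hu (in_WT_refl b).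
have lt : (Wlength D (u *m refl b) < Wlength D u)%N = (wact u b \notin posroots D).
  have := Wlength_refl hub bp; rewrite -mulmxA reflK mulmx1 => ->.
  rewrite (wactM _ hu (in_WT_refl b)) wact_refl -/(oppD b) (wact_oppD _ hu).
  exact: posroots_oppD.
rewrite rev_cons bruhat_path_rcons lt /= aff_refl0 -emulA linM.
rewrite (apos_min_lin (root_subsystemT D) hm (fun a _ => @mpos a) hu) ?in_DT //.
split=> [/andP [-> /IH h]|[h _ ->] /=]; first by split=> //; exact: h.
exact/IH.
Qed.

Lemma down_path_Wext (J : {set D}) (x y : ext n) p : {subset p <= J} ->
  in_Wext J x -> down_path x p y -> in_Wext J y.
Proof.
elim: p x => [|b p IH] x pJ hx /=; first by move=> /eqP <-.
move=> /andP [_]; apply: IH; first by move=> c cp; apply: pJ; rewrite inE cp orbT.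
by apply: in_Wext_mul => //; apply/in_Wext_aff_refl/pJ; rewrite mem_head.
Qed.

End BruhatPaths.

(** * Expansion of the bar of a translation *)

Section TranslationCoefficients.
Variables (R : rcfType) (n : nat) (D : rootDatum n) (q r : nat) (q_gt0 : (0 < q)%N).
Variables (J : {set D}) (hJ : root_subsystem J).
Variables (H : unitAlgType R) (T : ext n -> H) (hT : hecke_algebra q r J T).
Variables (l : seq D) (hl : initial_section J l).
Hypothesis lfull : forall a, a \in J -> a \in posroots D -> a \in l.
Implicit Types (x y z : ext n) (lambda : 'cV[int]_n).

Local Notation Q := (Qr R q r).
Local Notation Tt := (Ttilde q r J T).
Local Notation spanned := (spanned q r J T).

Lemma exists_min_rep lambda : exists2 v, in_W_ J v &
  forall w, in_W_ J w ->
    (ext_length R J (lambda, v) <= ext_length R J (lambda, w))%N.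
Proof.
pose P k := `[< exists2 w, in_W_ J w & ext_length R J (lambda, w) = k >].
have hex : exists k, P k.
  by exists (ext_length R J (lambda, 1%:M)); apply/asboolP; exists 1%:M; first exact: in_W_1.
case: (ex_minnP hex) => k /asboolP [v hv <-] hmin; exists v => // w hw.
by apply: hmin; apply/asboolP; exists w.
Qed.

Lemma path_sum_spanned u : in_W_ J u ->
  spanned (fun z => exists2 w, in_W_ J w & z = lin w) (path_sum q r J T l (lin u)).
Proof.
elim: (l) (hl) u => [|b l' IH] hl0 u hu.
  by apply: spannedT; exists u.
have [bJ _ _ _ hl'] := hl0; rewrite path_sum_lin //; apply: spannedD; first exact: IH.
case: ifP => _; first exact: spanned0.
by apply/spannedZ/IH => //; apply: in_W_mul => //; exact: in_W_refl.
Qed.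

(** The remainder comes from the lower terms of [Tbar] at the minimal element of the coset. It
    avoids this coset, hence does not affect the coefficients sought. *)
Lemma Tbar_transl lambda : exists2 h,
  spanned (fun z => in_Wext J z /\ z.1 != lambda) h &
  Tbar q r J T (transl lambda) = path_sum q r J T l (transl lambda) + h.
Proof.
have [v hv vmin] := exists_min_rep lambda.
have hm : in_Wext J (lambda, v) by [].
have mpos := min_rep_apos hJ hv vmin.
have hy := in_W_inv hv.
have em : transl lambda = emul (lambda, v) (lin (invmx v)).
  by rewrite /emul /= mulmx0 addr0 mulmxV // (in_W_unit hv).
have [h hspan eh] := Tbar_lower q_gt0 hJ hT hm.
exists (h * path_sum q r J T l (lin (invmx v))); last first.
  rewrite em (TbarM q_gt0 hJ hT) //; last exact: inversions_min_lin.
  rewrite eh (Tbar_path_sum q_gt0 hJ hT hl lfull hy) mulrDl.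
  by rewrite (min_path_sum hJ hT hm mpos hl hy).
apply: (spanned_linear (f := fun g => g * _) _ hspan) => [c g g'|z [hz lz]].
  by rewrite mulrDl scalerAl.
apply: (spanned_linear _ (path_sum_spanned hy)) => [c g g'|_ [w hw ->]].
  by rewrite mulrDr scalerAr.
apply: spanned_sub (Tt_mul_lin q_gt0 hJ hT hw hz) => y [hWy ->]; split=> //.
(* A lower term with translation part [lambda] would be shorter than the minimal element of its own
   coset. *)
apply/eqP => ez; have := vmin z.2 hz; rewrite -ez -surjective_pairing ez.
rewrite -leq_double !ext_lengthE //; move: lz.
by rewrite ltnNge => /negP h1 h2; apply: h1.
Qed.

Lemma Rtilde_transl (Rt : ext n -> ext n -> {poly int}) lambda w :
  Rtilde_polynomials q r J T Rt -> in_W_ J w ->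
  evalR (Rt (lambda, w) (transl lambda)) Q =
  \sum_(p <- subseqs l | down_path (transl lambda) p (lambda, w)) Q ^+ size p.
Proof.
move=> [_ hRt] hw.
have ht : in_Wext J (transl lambda) by exact: in_W_1.
have [s [us sW s0 es]] := hRt _ ht.
have [h [k [hk eh]] eT] := Tbar_transl lambda.
rewrite -/(Tbar q r J T (transl lambda)) eT eh path_sum_terms in es.
set c := fun x => evalR (Rt x (transl lambda)) Q in es.
(* The difference of the two expansions of the same element, as one vanishing combination to which
   [Tt_lindep] applies. *)
pose L := [seq (c x, x) | x <- s] ++
  ([seq (- t.1, t.2) | t <- path_terms R q r l (transl lambda)] ++
   [seq (- t.1, t.2) | t <- k]).
have LW t : t \in L -> in_Wext J t.2.
  rewrite !mem_cat => /or3P [] /mapP [y hy ->] /=.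
  - exact: sW.
  - by apply: path_terms_in hy => // a; exact: initial_section_in hl.
  - by case: (hk _ hy).
have neg (k' : seq (R * ext n)) : \sum_(t <- [seq (- t.1, t.2) | t <- k']) t.1 *: Tt t.2 =
    - \sum_(t <- k') t.1 *: Tt t.2.
  by rewrite big_map -sumrN; apply: eq_bigr => t _; rewrite scaleNr.
have L0 : \sum_(t <- L) t.1 *: Tt t.2 = 0.
  by rewrite !big_cat /= !neg big_map /= -es -opprD subrr.
have k0 : \sum_(t <- k | t.2 == (lambda, w)) t.1 = 0.
  rewrite big_seq_cond big_pred0 // => t; apply/negbTE/negP => /andP [tk /eqP et].
  by have [_] := hk _ tk; rewrite et eqxx.
have := Tt_lindep q_gt0 hT LW L0 (lambda, w); rewrite !big_cat !big_map /= !sumrN.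
rewrite path_terms_coef k0 subr0 => /eqP; rewrite subr_eq0 => /eqP <-.
have [ws|ws] := boolP ((lambda, w) \in s).
  by rewrite -big_filter filter_pred1_uniq // big_seq1.
rewrite -big_filter (_ : [seq _ <- _ | _] = [::]) ?big_nil.
  by rewrite s0 // /evalR map_polyC /= horner0.
by apply/eqP; rewrite -(negbK (_ == _)) -has_filter has_pred1.
Qed.

End TranslationCoefficients.

(** * From coefficients to increasing paths in the Weyl group *)

Theorem corollary4p21
  (R : rcfType) (n : nat) (D : rootDatum n) (hcenter : connected_center D)
  (q r : nat)
  (hq : exists p k : nat, [/\ prime p, (0 < k)%N & q = (p ^ k)%N])
  (hr : (1 <= r)%N)
  (prec : rel (affroot D)) (hprec : reflection_order R prec)
  (mu : 'cV[int]_n) (hdom : dominant D mu) (hmin : minuscule D mu)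
  (lambda : 'cV[int]_n) (wbar wlambda : 'M[int]_n)
  (hw : Adm R D mu (lambda, wbar)) (hlambda : is_min_rep R D lambda wlambda)
  (J : {set D}) (hJ : root_subsystem J)
  (H : unitAlgType R) (T : ext n -> H) (hT : hecke_algebra q r J T)
  (Rt : ext n -> ext n -> {poly int}) (hRt : Rtilde_polynomials q r J T Rt) :
  evalR (Rt (lambda, wbar) (transl lambda)) (Qr R q r) =
  \sum_(J' : {set D} | root_subsystem J' && (J' \subset J))
    \sum_(p \in [set p | increasing_paths prec (invmx wlambda *m wbar)
                           (invmx wlambda) p /\ is_JDelta p J']%classic)
      Qr R q r ^+ size p.
Proof.
have q_gt0 : (0 < q)%N.
  by case: hq => p [k [pp _ ->]]; rewrite expn_gt0 prime_gt0.
set Q := Qr R q r.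
have [hWw _] := hw.
have [hWl lmin] := hlambda.
have [l [sl ul hl]] := exists_section hprec J.
have lsub : {subset l <= [pred a | (a \in J) && (a \in posroots D)]}.
  by move=> a; rewrite hl.
have lin_l : initial_section J l.
  apply: (initial_section_below hprec hJ sl lsub) => b c _ cJ /and3P [_ cp _].
  by rewrite hl inE cJ.
have lfull a : a \in J -> a \in posroots D -> a \in l.
  by move=> aJ ap; rewrite hl inE aJ.
have lJ p : p \in subseqs l -> {subset p <= J}.
  by rewrite mem_subseqs => /mem_subseq h a /h /lsub /andP [].
have lpos p : p \in subseqs l -> {subset p <= posroots D}.
  by rewrite mem_subseqs => /mem_subseq h a /h /lsub /andP [].
have hunit := in_W_unit hWl; have hWi := in_W_inv hWl.
have et : transl lambda = emul (lambda, wlambda) (lin (invmx wlambda)).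
  by rewrite /emul /= mulmx0 addr0 mulmxV.
have ew : (lambda, wbar) = emul (lambda, wlambda) (lin (invmx wlambda *m wbar)).
  by rewrite /emul /= mulmx0 addr0 mulmxA mulmxV // mul1mx.
have mpos a : a \in posroots D -> apos (eacta (lambda, wlambda) (a, 0)).
  by apply: (min_rep_apos (root_subsystemT D) hWl lmin); rewrite in_DT.
have bridge p : p \in subseqs l -> down_path (transl lambda) p (lambda, wbar) <->
    bruhat_path (invmx wlambda *m wbar) (rev p) (invmx wlambda).
  by move=> hp; rewrite et ew; apply: down_bruhat => //; exact: lpos.
have -> : evalR (Rt (lambda, wbar) (transl lambda)) Q =
    \sum_(p <- subseqs l | down_path (transl lambda) p (lambda, wbar)) Q ^+ size p.
  (* Outside [W_J] the left side is zero by convention, and the right side is empty since a path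
     from [t_lambda] with edges in [J] stays in the extended group of [J]. *)
  have [hWJ|nWJ] := pselect (in_W_ J wbar).
    exact: (Rtilde_transl q_gt0 hJ hT lin_l lfull lambda hRt hWJ).
  have [h0 _] := hRt.
  rewrite h0 // /evalR map_polyC /= horner0 big_seq_cond big_pred0 // => p.
  apply/negP => /andP [/lJ pJ hp]; apply: nWJ.
  exact: (down_path_Wext pJ (in_W_1 J : in_Wext J (transl lambda)) hp).
(* Reversal turns the descending paths from [w_lambda^-1] into Bruhat paths ending there. *)
set S := [seq p <- map rev (subseqs l) |
  `[< bruhat_path (invmx wlambda *m wbar) p (invmx wlambda) >]].
have uS : uniq S.
  by apply: filter_uniq; rewrite (map_inj_uniq (inv_inj revK)); exact: uniq_subseqs.
(* The subsequences of the decreasing list [l] are the decreasing sequences of positive roots of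
   [J]; reversed, they are the increasing ones. *)
have hS p : all (mem J) p -> p \in S <-> increasing_paths prec (invmx wlambda *m wbar)
                           (invmx wlambda) p.
  move=> /allP pJ; rewrite mem_filter; split.
    move=> /andP [/asboolP hb /mapP [p' hp' e]]; split=> //.
    rewrite -(sorted_rev_below prec); last exact: bruhat_path_pos hb.
    rewrite e revK; apply: (subseq_sorted (@below_trans _ _ _ _ hprec)) sl.
    by rewrite -mem_subseqs.
  move=> [hb hs]; have hpos := bruhat_path_pos hb; apply/andP; split; first exact/asboolP.
  apply/mapP; exists (rev p); last by rewrite revK.
  rewrite mem_subseqs; apply: (sorted_subset_subseq hprec sl).
    by rewrite (sorted_rev_below prec).
  by move=> a; rewrite mem_rev hl inE => ap; apply/andP; split; [exact: (pJ _ ap)|exact: hpos].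
transitivity (\sum_(p <- S) Q ^+ size p).
  rewrite big_filter big_map; under [RHS]eq_bigr do rewrite size_rev.
  rewrite big_seq_cond [RHS]big_seq_cond; apply: eq_bigl => p.
  have [hp|//] := boolP (p \in subseqs l).
  by apply/idP/asboolP => /bridge; apply.
have SJ p : p \in S -> all (mem J) p.
  rewrite mem_filter => /andP [_ /mapP [p' hp' ->]]; rewrite all_rev; apply/allP.
  exact: lJ.
(* Each path has exactly one [J_Delta], contained in [J] because its edges are. *)
transitivity (\sum_(p <- S) \sum_(K : {set D} | (root_subsystem K && (K \subset J)) &&
    `[< is_JDelta p K >]) Q ^+ size p).
  rewrite big_seq [RHS]big_seq; apply: eq_bigr => p /SJ pJ.
  by rewrite sum_JDelta // pJ.
rewrite (exchange_big_dep (fun K : {set D} => root_subsystem K && (K \subset J))) /=; last first.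
  by move=> p K _ /andP [].
apply: eq_bigr => K /andP [hK KJ].
rewrite (eq_bigl (fun p => `[< is_JDelta p K >])); last by move=> p; rewrite hK KJ.
rewrite -big_filter fsbig_seq; last exact: filter_uniq.
apply: eq_fsbigl.
apply/predeqP => p; rewrite /= mem_filter; split=> [/andP [/asboolP dK pS]|[hp dK]].
  by split=> //; apply/hS => //; exact: SJ.
(* Conversely, [J_Delta = K] inside [J] forces the edges of the path into [J]. *)
rewrite asboolT //=; apply/hS => //.
by rewrite -(is_JDelta_sub hJ dK).
Qed.
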